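(* Let $a,b$ be complex numbers such that $1-(a+b)\notin\mathbb{N}=\{1,2,3,\dots\}$. Then for every $x\in\mathbb{C}\setminus[1,\infty)$, $$[\epsilon]\;{}_2F_1\left(\begin{array}{c}a+\epsilon\quad b+\epsilon\\ a+b\end{array};x\right)=\ln\frac{1}{1-x}\;\,{}_2F_1\left(\begin{array}{c}a\quad b\\ a+b\end{array};x\right).$$
   Context: The Pochhammer symbol is $(a)_k=a(a+1)\cdots(a+k-1)$, $(a)_0=1$. For $1-c\notin\mathbb{N}$, the Gauss hypergeometric function is ${}_2F_1\left(\begin{array}{c}a\quad b\\ c\end{array};x\right)=\sum_{k=0}^\infty\frac{(a)_k(b)_k}{(c)_k}\frac{x^k}{k!}$ for $|x|<1$, extended to $\mathbb{C}\setminus[1,\infty)$ by analytic continuation (principal branch). The logarithm is the principal one, $\ln\frac1{1-x}=-\operatorname{Log}(1-x)$. For a function $h(\epsilon)$ holomorphic near $\epsilon=0$, $[\epsilon]h(\epsilon)=h'(0)$ denotes its first Taylor coefficient in $\epsilon$ at $0$. *)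

(* Defs.v *)
From Stdlib Require Import Reals Factorial ClassicalEpsilon.
From Coquelicot Require Import Coquelicot.

Open Scope R_scope.
Open Scope C_scope.

Fixpoint pochhammer (a : C) (k : nat) : C :=
  match k with
  | O => 1
  | S k' => pochhammer a k' * (a + INR k')
  end.

Definition hyp2F1_coef (a b c : C) (k : nat) : C :=
  pochhammer a k * pochhammer b k / pochhammer c k / INR (fact k).

Definition analytic_at (f : C -> C) (z0 : C) : Prop :=
  exists (u : nat -> C) (r : R),
    (0 < r)%R /\
    forall z : C, (Cmod (z - z0) < r)%R -> is_pseries u (z - z0) (f z).

(* The cut plane, i.e. the complement of [1, +oo) *)
Definition slit_plane (x : C) : Prop := ~ (Im x = 0 /\ 1 <= Re x)%R.

Definition is_hyp2F1 (a b c : C) (F : C -> C) : Prop :=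
  (forall x : C, (Cmod x < 1)%R -> is_pseries (hyp2F1_coef a b c) x (F x)) /\
  (forall x : C, slit_plane x -> analytic_at F x).

(* The slit plane is connected and contains the unit disc, so [is_hyp2F1 a b c]
   determines the function on the slit plane. The values of [hyp2F1 a b c] on
   [1, +oo), and at every point when c is a non-positive integer, are not
   meaningful. *)
Definition hyp2F1 (a b c : C) : C -> C :=
  epsilon (inhabits (fun _ : C => RtoC 0)) (is_hyp2F1 a b c).

(* Principal argument, with values in (-PI, PI] for z <> 0 *)
Definition Arg (z : C) : R :=
  if Rle_dec 0 (Im z) then acos (Re z / Cmod z) else (- acos (Re z / Cmod z))%R.

Definition Log (z : C) : C := (ln (Cmod z), Arg z).

Definition holomorphic_near (h : C -> C) (z0 : C) : Prop :=
  locally (T := C_UniformSpace) z0 (fun z => ex_derive h z).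

(* The coefficient of eps in the Taylor expansion of h at 0; meaningful when
   [holomorphic_near h 0]. *)
Definition first_coef (h : C -> C) : C := C_derive h 0.

(* Main.v *)
Require Import Defs.
From Stdlib Require Import Reals Arith Lra Lia ClassicalEpsilon.
From Coquelicot Require Import Coquelicot.

Open Scope R_scope.
Open Scope C_scope.

(** Let F = 2F1(a, b; c; x). The map x = 4 w / (1 + w)^2 is a bijection from the unit
    disc to the cut plane; its inverse [disc_coord] is the Cayley transform of the
    square root of 1 - x with positive real part. In the coordinate w the
    hypergeometric equation becomes

      w g'' + (c + w P) g' + Q g = 0,
      P = 2 (c - 1) / (1 - w) + (2 - 4 (a + b)) / (1 - w^2),  Q = - 4 a b / (1 + w)^2,

    with P and Q analytic in the whole disc. The solution that is analytic at 0 is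
    therefore one power series, sum d_k w^k, converging in the whole disc: its
    recurrence divides by (k + 1) (k + c), and this beats the growth of the other
    terms ([fuchs_bound]). Near 0 it is the hypergeometric series composed with the
    substitution ([hyp2F1_koebe]), so by the identity theorem its sum at
    [disc_coord x] is the continuation of F to the cut plane ([hyp2F1_disc]).

    This single expansion also controls the dependence on the parameters. When a and b
    are both moved by eta, the first-order Taylor remainder of d_k solves the same
    recurrence with a source of size eta^2, so it is O(eta^2) uniformly against a
    geometric sequence ([disc_coef_taylor]). Hence F is holomorphic in eta, and its
    derivative is sum d'_k w^k with d' the solution of the differentiated recurrence
    ([hyp2F1_derive_parameter]).

    For c = a + b this derivative is explicit. Let L(w) = 2 log ((1 + w) / (1 - w)), so
    that L' = 4 / (1 - w^2). If Phi = sum d_k w^k, the product L Phi vanishes at 0 and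
    solves the differentiated equation: the terms with Phi' agree because 2 L' = - dP/d eta,
    and those with Phi because w L'' + (c + w P) L' = 4 c / (1 + w)^2 = - dQ/d eta, which is
    where c = a + b enters. By uniqueness sum d'_k w^k = L Phi ([disc_coef_deriv_log]). Finally
    L(w) = - Log (1 - x), because ((1 - w) / (1 + w))^2 = 1 - x and (1 - w) / (1 + w) stays
    in the right half-plane ([neg_Log_cayley], [log_series_eq]).

    The facts on complex power series that this needs (products, composition,
    recentring, identity theorem) all come from one exchange of summations,
    [fubini_series]. *)

(** * Series of complex numbers *)

Notation C_series := (@is_series C_AbsRing C_NormedModule) (only parsing).

Lemma functional_choice {A B : Type} (R : A -> B -> Prop) :
  (forall x, exists y, R x y) -> exists f : A -> B, forall x, R x (f x).
Proof.
  intros H. exists (fun x => proj1_sig (constructive_indefinite_description _ (H x))).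
  intros x. exact (proj2_sig (constructive_indefinite_description _ (H x))).
Qed.

Lemma Cmod_minus_sym (x y : C) : Cmod (x - y) = Cmod (y - x).
Proof. rewrite <- Cmod_opp. f_equal. ring. Qed.

Lemma Cmod_triangle_minus (x y : C) : (Cmod (x - y) <= Cmod x + Cmod y)%R.
Proof. unfold Cminus. rewrite <- (Cmod_opp y). apply Cmod_triangle. Qed.

Lemma Cmod_triangle_rev (x y : C) : (Cmod x - Cmod y <= Cmod (x - y))%R.
Proof.
  replace x with ((x - y) + y) at 1 by ring.
  pose proof (Cmod_triangle (x - y) y). lra.
Qed.

Lemma is_series_C_eps (f : nat -> C) (l : C) :
  C_series f l <->
  forall eps : R, (0 < eps)%R ->
    exists N : nat, forall n : nat, (N <= n)%nat -> (Cmod (sum_n f n - l) < eps)%R.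
Proof.
  unfold is_series.
  rewrite (filterlim_locally_ball_norm (U := C_NormedModule)).
  split.
  - intros H eps Heps. destruct (H (mkposreal eps Heps)) as [N HN].
    exists N. intros n Hn. specialize (HN n Hn).
    exact HN.
  - intros H eps. destruct (H eps (cond_pos eps)) as [N HN].
    exists N. intros n Hn. exact (HN n Hn).
Qed.

Lemma is_series_C_unique (f : nat -> C) (a b : C) :
  C_series f a -> C_series f b -> a = b.
Proof.
  intros Ha Hb.
  apply (filterlim_locally_unique (sum_n f) _ _ Ha Hb).
Qed.

Lemma ex_series_C_abs (f : nat -> C) (b : nat -> R) :
  (forall n, (Cmod (f n) <= b n)%R) -> ex_series b -> exists l : C, C_series f l.
Proof.
  intros Hf Hb.
  exact (ex_series_le (V := C_CompleteNormedModule) f b Hf Hb).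
Qed.

Lemma Cmod_sum_n (f : nat -> C) (b : nat -> R) (n : nat) :
  (forall k, (k <= n)%nat -> (Cmod (f k) <= b k)%R) ->
  (Cmod (sum_n f n) <= sum_n b n)%R.
Proof.
  induction n as [|n IH]; intros H.
  - rewrite !sum_O. apply H; lia.
  - rewrite !sum_Sn.
    eapply Rle_trans; [apply Cmod_triangle|].
    apply Rplus_le_compat; [apply IH; intros; apply H; lia|apply H; lia].
Qed.

Lemma sum_n_le_R (a b : nat -> R) (n : nat) :
  (forall k, (k <= n)%nat -> a k <= b k) -> sum_n a n <= sum_n b n.
Proof.
  intros H. induction n as [|n IH].
  - rewrite !sum_O. apply H; lia.
  - rewrite !sum_Sn. apply Rplus_le_compat; [apply IH; intros; apply H; lia|apply H; lia].
Qed.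

Lemma sum_n_le_series (b : nat -> R) (B : R) (n : nat) :
  (forall k, (0 <= b k)%R) -> is_series b B -> (sum_n b n <= B)%R.
Proof.
  intros Hb HB.
  apply (is_lim_seq_incr_compare (sum_n b) B HB).
  intros k. rewrite sum_Sn. unfold plus; simpl. specialize (Hb (S k)). lra.
Qed.

Lemma is_series_C_norm_le (f : nat -> C) (l : C) (b : nat -> R) (B : R) :
  C_series f l -> (forall n, (Cmod (f n) <= b n)%R) -> is_series b B ->
  (Cmod l <= B)%R.
Proof.
  intros Hf Hle HB. apply Rnot_lt_le. intros Hlt.
  destruct (proj1 (is_series_C_eps f l) Hf (Cmod l - B)%R) as [N HN]; [lra|].
  specialize (HN N (le_n _)).
  assert (H1 := Cmod_sum_n f b N (fun k _ => Hle k)).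
  assert (H2 : (sum_n b N <= B)%R).
  { apply sum_n_le_series; auto. intros k.
    eapply Rle_trans; [apply Cmod_ge_0|apply Hle]. }
  rewrite Cmod_minus_sym in HN.
  pose proof (Cmod_triangle_rev l (sum_n f N)). lra.
Qed.

Lemma is_series_C_plus (f g : nat -> C) (a b : C) :
  C_series f a -> C_series g b -> C_series (fun n => f n + g n) (a + b).
Proof. exact (is_series_plus (V := C_NormedModule) f g a b). Qed.

Lemma is_series_C_scal (c : C) (f : nat -> C) (a : C) :
  C_series f a -> C_series (fun n => c * f n) (c * a).
Proof. exact (is_series_scal (V := C_NormedModule) c f a). Qed.

Lemma is_series_C_minus (f g : nat -> C) (a b : C) :
  C_series f a -> C_series g b -> C_series (fun n => f n - g n) (a - b).
Proof. exact (is_series_minus (V := C_NormedModule) f g a b). Qed.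

Lemma is_series_C_sum_n (f : nat -> nat -> C) (l : nat -> C) (m : nat) :
  (forall k, C_series (f k) (l k)) ->
  C_series (fun n => sum_n (fun k => f k n) m) (sum_n l m).
Proof.
  intros H. induction m as [|m IH].
  - rewrite sum_O. eapply is_series_ext; [|apply (H 0%nat)].
    intros n. now rewrite sum_O.
  - rewrite sum_Sn.
    eapply is_series_ext; [|apply (is_series_C_plus _ _ _ _ IH (H (S m)))].
    intros n. now rewrite sum_Sn.
Qed.

Lemma is_series_finite {K : AbsRing} {V : NormedModule K} (f : nat -> V) (m : nat) :
  (forall k, (m < k)%nat -> f k = zero) -> is_series f (sum_n f m).
Proof.
  intros H. unfold is_series.
  apply (filterlim_ext_loc (fun _ => sum_n f m)); [|apply filterlim_const].
  exists m. intros n Hn. induction Hn as [|n Hn IH]; [reflexivity|].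
  rewrite sum_Sn, <- IH, (H (S n)) by lia. now rewrite plus_zero_r.
Qed.

Lemma is_series_drop {K : AbsRing} {V : NormedModule K} (f : nat -> V) (l : V) (m : nat) :
  is_series f l ->
  is_series (fun n => if le_dec n m then zero else f n) (minus l (sum_n f m)).
Proof.
  intros H.
  replace (sum_n f m) with (sum_n (fun n => if le_dec n m then f n else zero) m).
  - assert (Hf : is_series (fun n => if le_dec n m then f n else zero)
                   (sum_n (fun n => if le_dec n m then f n else zero) m)).
    { apply is_series_finite. intros k Hk. destruct (le_dec k m); [lia|reflexivity]. }
    eapply is_series_ext; [|apply (is_series_minus _ _ _ _ H Hf)].
    intros n. simpl. destruct (le_dec n m).
    + exact (plus_opp_r (G := NormedModule.AbelianGroup K V) (f n)).
    + transitivity (plus (f n) zero); [f_equal|exact (plus_zero_r (f n))].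
      exact (opp_zero (G := NormedModule.AbelianGroup K V)).
  - apply sum_n_ext_loc. intros k Hk. destruct (le_dec k m); [reflexivity|lia].
Qed.

(** Dominated convergence for series: the head of the sum is small because each
    of its terms is, the tail because the dominating series has a small tail. *)
Lemma tannery (f : nat -> nat -> C) (A : nat -> R) (s : nat -> C) :
  ex_series A ->
  (forall n N, (Cmod (f n N) <= A n)%R) ->
  (forall n eps, (0 < eps)%R ->
     exists N0, forall N, (N0 <= N)%nat -> (Cmod (f n N) < eps)%R) ->
  (forall N, C_series (fun n => f n N) (s N)) ->
  forall eps, (0 < eps)%R ->
    exists N0, forall N, (N0 <= N)%nat -> (Cmod (s N) < eps)%R.
Proof.
  intros [B HB] Hdom Hlim Hs eps Heps.
  assert (HA : forall n, (0 <= A n)%R).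
  { intros n. eapply Rle_trans; [apply Cmod_ge_0|apply (Hdom n 0%nat)]. }
  assert (Htail : exists m, (B - sum_n A m < eps / 2)%R).
  { assert (HB' : is_lim_seq (sum_n A) B) by exact HB.
    apply is_lim_seq_spec in HB'.
    destruct (HB' (mkposreal (eps / 2) ltac:(lra))) as [m Hm].
    exists m. specialize (Hm m (le_n _)). simpl in Hm.
    apply Rabs_def2 in Hm. lra. }
  destruct Htail as [m Hm].
  assert (Hhead : forall M (d : R), (0 < d)%R -> exists N0, forall N, (N0 <= N)%nat ->
            (Cmod (sum_n (fun n => f n N) M) < d)%R).
  { induction M as [|M IH]; intros d Hd.
    - destruct (Hlim 0%nat d Hd) as [N0 HN]. exists N0. intros N HNN.
      rewrite sum_O. auto.
    - destruct (IH (d / 2)%R) as [N1 H1]; [lra|].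
      destruct (Hlim (S M) (d / 2)%R) as [N2 H2]; [lra|].
      exists (N1 + N2)%nat. intros N HN. rewrite sum_Sn.
      eapply Rle_lt_trans; [apply Cmod_triangle|].
      specialize (H1 N ltac:(lia)). specialize (H2 N ltac:(lia)). lra. }
  destruct (Hhead m (eps / 2)%R) as [N0 HN0]; [lra|].
  exists N0. intros N HN. specialize (HN0 N HN).
  set (h := sum_n (fun n => f n N) m) in *.
  assert (Hd : (Cmod (s N - h) <= B - sum_n A m)%R).
  { apply (is_series_C_norm_le _ _ (fun n => if le_dec n m then zero else A n) _
             (is_series_drop _ _ m (Hs N))).
    - intros n. simpl. destruct (le_dec n m).
      + exact (Req_le _ _ Cmod_0).
      + apply Hdom.
    - exact (is_series_drop A B m HB). }
  replace (s N) with ((s N - h) + h) by ring.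
  eapply Rle_lt_trans; [apply Cmod_triangle|]. lra.
Qed.

(** Rows of an absolutely summable array may be exchanged with columns: the
    error after N columns is a series over the rows to which dominated
    convergence applies. *)
Lemma fubini_series (T : nat -> nat -> C) (B : nat -> nat -> R) (A : nat -> R)
    (r : nat -> C) (s : C) :
  (forall n m, (Cmod (T n m) <= B n m)%R) ->
  (forall n, is_series (B n) (A n)) -> ex_series A ->
  (forall n, C_series (T n) (r n)) -> C_series r s ->
  exists c : nat -> C, (forall m, C_series (fun n => T n m) (c m)) /\ C_series c s.
Proof.
  intros HT HB HA Hr Hs.
  assert (HB0 : forall n m, (0 <= B n m)%R).
  { intros n m. eapply Rle_trans; [apply Cmod_ge_0|apply HT]. }
  assert (Hle : forall n m, (B n m <= A n)%R).
  { intros n m. eapply Rle_trans; [|apply (sum_n_le_series _ _ m (HB0 n) (HB n))].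
    destruct m as [|m]; [rewrite sum_O; lra|]. rewrite sum_Sn. unfold plus; simpl.
    assert (0 <= sum_n (B n) m)%R; [|lra].
    clear -HB0. induction m as [|m IH]; [rewrite sum_O; apply HB0|].
    rewrite sum_Sn. unfold plus; simpl. specialize (HB0 n (S m)). lra. }
  assert (Hc : forall m, exists l : C, C_series (fun n => T n m) l).
  { intros m. apply (ex_series_C_abs _ A); [|assumption].
    intros n. eapply Rle_trans; [apply HT|apply Hle]. }
  destruct (functional_choice _ Hc) as [c Hcs]. exists c. split; [assumption|].
  apply is_series_C_eps.
  assert (HN : forall N, C_series (fun n => r n - sum_n (T n) N) (s - sum_n c N)).
  { intros N. apply is_series_C_minus; [assumption|].
    exact (is_series_C_sum_n (fun m n => T n m) c N Hcs). }
  intros eps Heps.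
  destruct (tannery (fun n N => r n - sum_n (T n) N) A (fun N => s - sum_n c N) HA)
    with (eps := eps) as [N0 HN0]; try assumption.
  - intros n N.
    apply (is_series_C_norm_le _ _ (B n) _ (is_series_drop _ _ N (Hr n))).
    + intros m. simpl. destruct (le_dec m N).
      * eapply Rle_trans; [exact (Req_le _ _ Cmod_0)|apply HB0].
      * apply HT.
    + apply HB.
  - intros n e He.
    destruct (proj1 (is_series_C_eps _ _) (Hr n) e He) as [N0 H0]. exists N0.
    intros N HNN. rewrite Cmod_minus_sym. now apply H0.
  - exists N0. intros n Hn. rewrite Cmod_minus_sym. now apply HN0.
Qed.

(** * Complex derivatives *)

Notation C_is_derive := (@is_derive C_AbsRing C_NormedModule) (only parsing).

Lemma locally_C_abs (z : C) (P : C -> Prop) :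
  locally (T := AbsRing_UniformSpace C_AbsRing) z P <->
  exists d : R, (0 < d)%R /\ forall h, (Cmod h < d)%R -> P (z + h).
Proof.
  split.
  - intros [d Hd]. exists d. split; [apply cond_pos|]. intros h Hh.
    apply Hd. change (Cmod ((z + h) - z) < d)%R. now replace (z + h - z) with h by ring.
  - intros [d [Hd H]]. exists (mkposreal d Hd). intros y Hy.
    replace y with (z + (y - z)) by ring. apply H. exact Hy.
Qed.

Lemma is_derive_C_eps (f : C -> C) (z l : C) :
  C_is_derive f z l <->
  forall eps : R, (0 < eps)%R -> exists d : R, (0 < d)%R /\
    forall h, (Cmod h < d)%R -> (Cmod (f (z + h) - f z - h * l) <= eps * Cmod h).
Proof.
  split.
  - intros [_ H] eps Heps.
    assert (Hz : is_filter_lim (locally (T := AbsRing_UniformSpace C_AbsRing) z) z)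
      by (intros P HP; exact HP).
    specialize (H z Hz (mkposreal eps Heps)).
    apply (locally_C_abs z) in H. destruct H as [d [Hd H]].
    exists d. split; [assumption|]. intros h Hh. specialize (H h Hh). simpl in H.
    change (Cmod (f (z + h) - f z - (z + h - z) * l) <= eps * Cmod (z + h - z)) in H.
    now replace (z + h - z) with h in H by ring.
  - intros H. split.
    + apply is_linear_scal_l.
    + intros y Hy eps.
      assert (Hzy : z = y)
        by exact (is_filter_lim_locally_unique (V := AbsRing_NormedModule C_AbsRing) _ _ Hy).
      subst y.
      apply (locally_C_abs z). destruct (H eps (cond_pos eps)) as [d [Hd H']].
      exists d. split; [assumption|]. intros h Hh. specialize (H' h Hh).
      change (Cmod (f (z + h) - f z - (z + h - z) * l) <= eps * Cmod (z + h - z)).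
      now replace (z + h - z) with h by ring.
Qed.

(** C is a normed module over itself in two ways, with uniform structures given by
    discs and by squares. Differentiability sees only the norm, which they share, so
    that the product and chain rules for the first carry over to the second. *)
Lemma is_derive_C_abs (f : C -> C) (z l : C) :
  @is_derive C_AbsRing (AbsRing_NormedModule C_AbsRing) f z l <-> C_is_derive f z l.
Proof.
  split; intros [[H1 H2 H3] H]; (split; [split; [exact H1|exact H2|exact H3]|exact H]).
Qed.

Lemma is_derive_C_ext_near (f g : C -> C) (z l : C) (d : R) :
  0 < d -> (forall y, Cmod (y - z) < d -> f y = g y) ->
  C_is_derive f z l -> C_is_derive g z l.
Proof.
  intros Hd Hfg. apply is_derive_ext_loc. apply (locally_C_abs z).
  exists d. split; [assumption|]. intros h Hh. apply Hfg.
  now replace (z + h - z) with h by ring.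
Qed.

Lemma is_derive_C_mult (f g : C -> C) (z df dg : C) :
  C_is_derive f z df -> C_is_derive g z dg ->
  C_is_derive (fun t => f t * g t) z (df * g z + f z * dg).
Proof.
  intros Hf Hg. apply is_derive_C_abs in Hf. apply is_derive_C_abs in Hg.
  apply is_derive_C_abs.
  exact (is_derive_mult f g z df dg Hf Hg Cmult_comm).
Qed.

Lemma is_derive_C_comp (f g : C -> C) (z df dg : C) :
  C_is_derive f (g z) df -> C_is_derive g z dg ->
  C_is_derive (fun t => f (g t)) z (dg * df).
Proof.
  intros Hf Hg. apply is_derive_C_abs in Hg.
  exact (is_derive_comp (V := C_NormedModule) f g z df dg Hf Hg).
Qed.

Lemma is_derive_C_plus (f g : C -> C) (z df dg : C) :
  C_is_derive f z df -> C_is_derive g z dg ->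
  C_is_derive (fun t => f t + g t) z (df + dg).
Proof. exact (is_derive_plus (V := C_NormedModule) f g z df dg). Qed.

Lemma is_derive_C_const (a z : C) : C_is_derive (fun _ => a) z (RtoC 0).
Proof. exact (is_derive_const (V := C_NormedModule) a z). Qed.

Lemma is_derive_C_id (z : C) : C_is_derive (fun t => t) z (RtoC 1).
Proof. apply is_derive_C_abs. exact (is_derive_id z). Qed.

Lemma is_derive_C_inv (z : C) : z <> 0 -> C_is_derive Cinv z (- / (z * z)).
Proof.
  intros Hz. assert (Hm : 0 < Cmod z) by now apply Cmod_gt_0.
  apply is_derive_C_eps. intros eps Heps.
  set (m := Cmod z) in *.
  assert (Hm3 : 0 < eps * (m * m * m) / 2).
  { repeat apply Rmult_lt_0_compat; lra. }
  exists (Rmin (m / 2) (eps * (m * m * m) / 2))%R. split.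
  { apply Rmin_glb_lt; lra. }
  intros h Hh.
  assert (H1 := Rlt_le_trans _ _ _ Hh (Rmin_l _ _)).
  assert (H2 := Rlt_le_trans _ _ _ Hh (Rmin_r _ _)).
  assert (Hzh : m / 2 < Cmod (z + h)).
  { pose proof (Cmod_triangle_rev z (- h)) as H. rewrite Cmod_opp in H.
    replace (z - - h) with (z + h) in H by ring. fold m in H. lra. }
  assert (Hne : z + h <> 0) by (apply Cmod_gt_0; lra).
  replace (/ (z + h) - / z - h * - / (z * z)) with (h * h / ((z + h) * (z * z)))
    by (field; tauto).
  rewrite Cmod_div by (repeat apply Cmult_neq_0; assumption).
  rewrite !Cmod_mult. fold m.
  apply (Rmult_le_reg_r (Cmod (z + h) * (m * m)));
    [repeat apply Rmult_lt_0_compat; lra|].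
  unfold Rdiv. rewrite Rmult_assoc, Rinv_l, Rmult_1_r
    by (apply Rgt_not_eq; repeat apply Rmult_lt_0_compat; lra).
  pose proof (Cmod_ge_0 h) as Hh0.
  replace (eps * Cmod h * (Cmod (z + h) * (m * m)))%R
    with (Cmod h * (eps * (Cmod (z + h) * (m * m))))%R by ring.
  apply Rmult_le_compat_l; [assumption|].
  apply Rlt_le. eapply Rlt_le_trans; [exact H2|].
  replace (eps * (m * m * m) / 2)%R with (eps * ((m / 2) * (m * m)))%R by field.
  apply Rmult_le_compat_l; [lra|]. apply Rmult_le_compat_r; [nra|lra].
Qed.

Lemma is_derive_C_unique (f : C -> C) (z a b : C) :
  C_is_derive f z a -> C_is_derive f z b -> a = b.
Proof. intros Ha Hb. now rewrite <- (is_C_derive_unique _ _ _ Ha), (is_C_derive_unique _ _ _ Hb). Qed.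

(** * Power series *)

Definition ps_on (r : R) (u : nat -> C) (f : C -> C) : Prop :=
  forall z : C, Cmod z < r -> is_pseries u z (f z).

Lemma is_pseries_C (u : nat -> C) (z l : C) :
  is_pseries u z l <-> C_series (fun k => u k * z ^ k) l.
Proof.
  assert (E : forall k, scal (pow_n z k) (u k) = u k * z ^ k).
  { intros k. rewrite (Cmult_comm (u k)).
    change (pow_n z k * u k = z ^ k * u k). apply (f_equal (fun t => t * u k)).
    induction k as [|k IH]; [reflexivity|]. simpl. now rewrite IH. }
  split; apply is_series_ext; intros k; now rewrite E.
Qed.

Lemma ps_on_series r u f z :
  ps_on r u f -> Cmod z < r -> C_series (fun k => u k * z ^ k) (f z).
Proof. intros H Hz. exact (proj1 (is_pseries_C _ _ _) (H z Hz)). Qed.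

Lemma ps_on_intro r u f :
  (forall z, Cmod z < r -> C_series (fun k => u k * z ^ k) (f z)) -> ps_on r u f.
Proof. intros H z Hz. exact (proj2 (is_pseries_C _ _ _) (H z Hz)). Qed.

Lemma ps_on_ext r u v f g :
  (forall k, u k = v k) -> (forall z, Cmod z < r -> f z = g z) ->
  ps_on r u f -> ps_on r v g.
Proof.
  intros Huv Hfg H. apply ps_on_intro. intros z Hz. rewrite <- Hfg by assumption.
  apply (is_series_ext (fun k => u k * z ^ k)); [intros; now rewrite Huv|].
  now apply (ps_on_series r).
Qed.

Lemma ps_on_mono r s u f : s <= r -> ps_on r u f -> ps_on s u f.
Proof. intros Hs H z Hz. apply H. lra. Qed.

Lemma Cmod_bounded_prefix (f : nat -> C) (N : nat) :
  exists M : R, forall k, (k <= N)%nat -> Cmod (f k) <= M.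
Proof.
  induction N as [|N [M HM]].
  - exists (Cmod (f 0%nat)). intros k Hk. replace k with 0%nat by lia. lra.
  - exists (Rmax M (Cmod (f (S N)))). intros k Hk.
    destruct (Nat.eq_dec k (S N)) as [->|Hne]; [apply Rmax_r|].
    eapply Rle_trans; [apply HM; lia|apply Rmax_l].
Qed.

Lemma C_series_terms_bounded (f : nat -> C) (l : C) :
  C_series f l -> exists M : R, forall k, Cmod (f k) <= M.
Proof.
  intros H. destruct (proj1 (is_series_C_eps f l) H 1%R Rlt_0_1) as [N HN].
  destruct (Cmod_bounded_prefix f N) as [M HM].
  exists (Rmax M 2). intros k.
  destruct (le_lt_dec k N) as [Hk|Hk].
  { eapply Rle_trans; [now apply HM|apply Rmax_l]. }
  eapply Rle_trans; [|apply Rmax_r].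
  destruct k as [|k]; [lia|].
  pose proof (HN k ltac:(lia)) as H1. pose proof (HN (S k) ltac:(lia)) as H2.
  rewrite sum_Sn in H2. change (plus ?a ?b) with (a + b) in H2.
  replace (f (S k)) with ((sum_n f k + f (S k) - l) - (sum_n f k - l)) by ring.
  eapply Rle_trans; [apply Cmod_triangle_minus|]. lra.
Qed.

Lemma Cmod_nonneg_real (x : R) : 0 <= x -> Cmod (RtoC x) = x.
Proof. intros H. rewrite Cmod_R. now apply Rabs_pos_eq. Qed.

Lemma ex_series_geom_bound (a : nat -> R) (M rho s : R) :
  0 <= rho < s -> (forall k, 0 <= a k) -> (forall k, a k * s ^ k <= M)%R ->
  ex_series (fun k => a k * rho ^ k)%R.
Proof.
  intros Hrs Ha HM.
  apply (ex_series_le (V := R_CompleteNormedModule) _ (fun k => M * (rho / s) ^ k)%R).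
  - intros k. change (Rabs (a k * rho ^ k) <= M * (rho / s) ^ k).
    assert (Hr : (0 <= rho ^ k)%R) by (apply pow_le; lra).
    rewrite Rabs_pos_eq by (apply Rmult_le_pos; auto).
    assert (Hs : (0 < s ^ k)%R) by (apply pow_lt; lra).
    unfold Rdiv. rewrite Rpow_mult_distr, pow_inv.
    replace (a k * rho ^ k)%R with ((a k * s ^ k) * (rho ^ k * / s ^ k))%R
      by (field; lra).
    apply Rmult_le_compat_r; [|apply HM].
    apply Rmult_le_pos; [assumption|]. apply Rlt_le, Rinv_0_lt_compat; assumption.
  - apply (ex_series_scal_l (V := R_NormedModule)), ex_series_geom.
    rewrite Rabs_pos_eq.
    + apply Rlt_div_l; lra.
    + apply Rdiv_le_0_compat; lra.
Qed.

Lemma ps_on_coef_bound r u f (s : R) :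
  ps_on r u f -> 0 <= s < r -> exists M : R, forall k, Cmod (u k) * s ^ k <= M.
Proof.
  intros H Hs.
  assert (Hc : Cmod (RtoC s) < r) by (rewrite Cmod_nonneg_real; lra).
  destruct (C_series_terms_bounded _ _ (ps_on_series _ _ _ _ H Hc)) as [M HM].
  exists M. intros k. specialize (HM k).
  now rewrite Cmod_mult, Cmod_pow, Cmod_nonneg_real in HM by lra.
Qed.

Lemma ps_on_abs r u f (rho : R) :
  ps_on r u f -> 0 <= rho < r -> ex_series (fun k => Cmod (u k) * rho ^ k)%R.
Proof.
  intros H Hr.
  destruct (ps_on_coef_bound r u f ((rho + r) / 2) H ltac:(lra)) as [M HM].
  apply (ex_series_geom_bound _ M rho ((rho + r) / 2)); [lra| |assumption].
  intros; apply Cmod_ge_0.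
Qed.

Lemma ps_on_of_bounds r u :
  (forall s, 0 <= s < r -> exists M : R, forall k, Cmod (u k) * s ^ k <= M) ->
  exists f, ps_on r u f.
Proof.
  intros H.
  assert (Hz : forall z, exists l, Cmod z < r -> C_series (fun k => u k * z ^ k) l).
  { intros z. destruct (Rlt_dec (Cmod z) r) as [Hz|Hz]; [|exists (RtoC 0); tauto].
    pose proof (Cmod_ge_0 z) as H0.
    destruct (H ((Cmod z + r) / 2)%R ltac:(lra)) as [M HM].
    destruct (ex_series_C_abs (fun k => u k * z ^ k) (fun k => Cmod (u k) * Cmod z ^ k)%R)
      as [l Hl].
    - intros n. rewrite Cmod_mult, Cmod_pow. lra.
    - apply (ex_series_geom_bound _ M _ ((Cmod z + r) / 2)); [lra| |assumption].
      intros; apply Cmod_ge_0.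
    - exists l. auto. }
  destruct (functional_choice _ Hz) as [f Hf].
  exists f. apply ps_on_intro. auto.
Qed.

Lemma ps_on_bounded r u f (s : R) :
  ps_on r u f -> 0 <= s < r -> exists M : R, 0 <= M /\ forall z, Cmod z <= s -> Cmod (f z) <= M.
Proof.
  intros H Hs. destruct (ps_on_abs r u f s H Hs) as [M HM].
  assert (HM' : is_series (fun k => Cmod (u k) * s ^ k)%R M) by exact HM.
  assert (Hb : forall z, Cmod z <= s -> Cmod (f z) <= M).
  { intros z Hz.
    apply (is_series_C_norm_le _ _ _ _ (ps_on_series r u f z H ltac:(lra))) with (2 := HM').
    intros k. rewrite Cmod_mult, Cmod_pow.
    apply Rmult_le_compat_l; [apply Cmod_ge_0|].
    apply pow_incr. split; [apply Cmod_ge_0|assumption]. }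
  exists M. split; [|assumption].
  eapply Rle_trans; [apply Cmod_ge_0|]. apply (Hb 0). rewrite Cmod_0; lra.
Qed.

Lemma ps_on_at_0 r u f : 0 < r -> ps_on r u f -> f 0 = u 0%nat.
Proof.
  intros Hr H. apply (is_series_C_unique (fun k => u k * 0 ^ k)).
  - apply (ps_on_series r); [assumption|]. now rewrite Cmod_0.
  - replace (u 0%nat) with (sum_n (fun k => u k * 0 ^ k) 0)
      by (rewrite sum_O; simpl; ring).
    apply (is_series_finite (V := C_NormedModule)). intros [|k] Hk; [lia|]. simpl.
    change (u (S k) * (0 * 0 ^ k) = 0). ring.
Qed.

Lemma ps_on_plus r u v f g :
  ps_on r u f -> ps_on r v g -> ps_on r (fun k => u k + v k) (fun z => f z + g z).
Proof.
  intros Hu Hv. apply ps_on_intro. intros z Hz.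
  eapply is_series_ext;
    [|apply (is_series_C_plus _ _ _ _ (ps_on_series r u f z Hu Hz) (ps_on_series r v g z Hv Hz))].
  intros k. simpl. ring.
Qed.

Lemma ps_on_scal r c u f :
  ps_on r u f -> ps_on r (fun k => c * u k) (fun z => c * f z).
Proof.
  intros Hu. apply ps_on_intro. intros z Hz.
  eapply is_series_ext; [|apply (is_series_C_scal c _ _ (ps_on_series r u f z Hu Hz))].
  intros k. simpl. ring.
Qed.

Lemma ps_on_const r c : ps_on r (fun k => match k with O => c | _ => 0 end) (fun _ => c).
Proof.
  apply ps_on_intro. intros z Hz.
  pose (t := fun k => (match k with O => c | _ => 0 end) * z ^ k).
  assert (E : sum_n t 0 = c) by (rewrite sum_O; unfold t; simpl; ring).
  change (C_series t c). rewrite <- E.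
  apply (is_series_finite (V := C_NormedModule) t 0). intros [|k] Hk; [lia|]. unfold t.
  change (0 * z ^ S k = 0). ring.
Qed.

(** Factoring out [z] lowers every index by one; continuity and the derivative at 0
    are read off from one or two such factorisations. *)
Lemma ps_on_tail r u f :
  ps_on r u f ->
  exists g, ps_on r (fun k => u (S k)) g /\ forall z, Cmod z < r -> f z = u 0%nat + z * g z.
Proof.
  intros H.
  destruct (Rlt_dec 0 r) as [Hr|Hr].
  2:{ exists (fun _ => 0). split; intros z Hz; exfalso; pose proof (Cmod_ge_0 z); lra. }
  exists (fun z : C => if excluded_middle_informative (z = 0) then u 1%nat else (f z - u 0%nat) / z).
  split.
  - apply ps_on_intro. intros z Hz.
    destruct (excluded_middle_informative (z = 0)) as [->|Hz0].
    + replace (u 1%nat) with (sum_n (fun k => u (S k) * 0 ^ k) 0)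
        by (rewrite sum_O; simpl; ring).
      apply (is_series_finite (V := C_NormedModule)). intros [|k] Hk; [lia|].
      change (u (S (S k)) * (0 * 0 ^ k) = 0). ring.
    + pose proof (ps_on_series r u f z H Hz) as Hs.
      assert (Hi : C_series (fun k => u (S k) * z ^ S k) (f z - u 0%nat)).
      { apply (is_series_incr_1 (V := C_NormedModule) (fun k => u k * z ^ k)).
        change (C_series (fun k => u k * z ^ k) (f z - u 0%nat + u 0%nat * 1)).
        now replace (f z - u 0%nat + u 0%nat * 1) with (f z) by ring. }
      replace ((f z - u 0%nat) / z) with (/ z * (f z - u 0%nat)) by (field; assumption).
      eapply is_series_ext; [|apply (is_series_C_scal (/ z) _ _ Hi)].
      intros k. simpl. field. assumption.
  - intros z Hz. destruct (excluded_middle_informative (z = 0)) as [->|Hz0].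
    + rewrite (ps_on_at_0 r u f Hr H). ring.
    + field. assumption.
Qed.

Lemma ps_on_derive_0 r u f : 0 < r -> ps_on r u f -> C_is_derive f (RtoC 0) (u 1%nat).
Proof.
  intros Hr H.
  destruct (ps_on_tail r u f H) as [g [Hg Hfg]].
  destruct (ps_on_tail _ _ _ Hg) as [g2 [Hg2 Hgg]].
  destruct (ps_on_bounded r _ g2 (r / 2) Hg2 ltac:(lra)) as [M [HM0 HM]].
  apply is_derive_C_eps. intros eps Heps.
  exists (Rmin (r / 2) (eps / (M + 1))). split.
  { apply Rmin_glb_lt; [lra|]. apply Rdiv_lt_0_compat; lra. }
  intros h Hh.
  assert (H1 := Rlt_le_trans _ _ _ Hh (Rmin_l _ _)).
  assert (H2 := Rlt_le_trans _ _ _ Hh (Rmin_r _ _)).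
  replace (0 + h) with h by ring.
  rewrite (Hfg h), (Hgg h), (ps_on_at_0 r u f Hr H) by lra.
  replace (u 0%nat + h * (u 1%nat + h * g2 h) - u 0%nat - h * u 1%nat)
    with (h * g2 h * h) by ring.
  rewrite !Cmod_mult.
  apply Rmult_le_compat_r; [apply Cmod_ge_0|].
  specialize (HM h ltac:(lra)).
  apply Rle_trans with (eps / (M + 1) * (M + 1))%R; [|right; field; lra].
  apply Rmult_le_compat; try apply Cmod_ge_0; lra.
Qed.

(** Zeros accumulating at the centre kill the coefficients one after the other:
    the constant term by continuity, then the same for the quotient by z. *)
Lemma ps_on_zero r u f :
  0 < r -> ps_on r u f ->
  (forall d, 0 < d -> exists h : C, h <> 0 /\ Cmod h < d /\ f h = 0) ->
  forall k, u k = 0.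
Proof.
  intros Hr Hf Hz k. revert u f Hf Hz.
  assert (H0 : forall u f, ps_on r u f ->
            (forall d, 0 < d -> exists h : C, h <> 0 /\ Cmod h < d /\ f h = 0) -> u 0%nat = 0).
  { intros u f Hf Hz. destruct (ps_on_tail r u f Hf) as [g [Hg Hfg]].
    destruct (ps_on_bounded r _ g (r / 2) Hg ltac:(lra)) as [M [HM0 HM]].
    apply Cmod_eq_0. destruct (Cmod_ge_0 (u 0%nat)) as [Hpos|H]; [|now symmetry].
    exfalso.
    destruct (Hz (Rmin (r / 2) (Cmod (u 0%nat) / (M + 1)))) as [h [_ [Hh Hfh]]].
    { apply Rmin_glb_lt; [lra|]. apply Rdiv_lt_0_compat; lra. }
    assert (H1 := Rlt_le_trans _ _ _ Hh (Rmin_l _ _)).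
    assert (H2 := Rlt_le_trans _ _ _ Hh (Rmin_r _ _)).
    rewrite Hfg in Hfh by lra.
    assert (E : u 0%nat = - (h * g h)).
    { replace (u 0%nat) with (u 0%nat + h * g h - h * g h) by ring. rewrite Hfh. ring. }
    assert (Hc : Cmod (u 0%nat) <= Cmod h * M).
    { rewrite E, Cmod_opp, Cmod_mult. apply Rmult_le_compat_l; [apply Cmod_ge_0|].
      apply HM. lra. }
    apply Rlt_div_r in H2; [|lra]. pose proof (Cmod_ge_0 h). nra. }
  induction k as [|k IH]; intros u f Hf Hz; [now apply (H0 u f)|].
  destruct (ps_on_tail r u f Hf) as [g [Hg Hfg]].
  apply (IH (fun k => u (S k)) g Hg).
  intros d Hd. destruct (Hz (Rmin d r)) as [h [Hh0 [Hh Hfh]]]; [now apply Rmin_glb_lt|].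
  assert (H1 := Rlt_le_trans _ _ _ Hh (Rmin_l _ _)).
  assert (H2 := Rlt_le_trans _ _ _ Hh (Rmin_r _ _)).
  exists h. repeat split; [assumption|lra|].
  rewrite Hfg, (H0 u f Hf Hz) in Hfh by lra.
  replace (g h) with (/ h * (0 + h * g h)) by (field; assumption).
  rewrite Hfh. ring.
Qed.

Lemma ps_on_unique r u v f : 0 < r -> ps_on r u f -> ps_on r v f -> forall k, u k = v k.
Proof.
  intros Hr Hu Hv k.
  assert (H : u k + (- (1)) * v k = 0).
  { apply (ps_on_zero r (fun k => u k + (- (1)) * v k) (fun z => f z + (- (1)) * f z) Hr).
    - apply ps_on_plus; [assumption|]. now apply ps_on_scal.
    - intros d Hd. exists (RtoC (d / 2)). repeat split.
      + intros E. apply RtoC_inj in E. lra.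
      + rewrite Cmod_nonneg_real; lra.
      + ring. }
  replace (u k) with (u k + (- (1)) * v k + v k) by ring. rewrite H. ring.
Qed.

(** * Products of power series *)

Definition conv (u v : nat -> C) (n : nat) : C := sum_n (fun k => u k * v (n - k)%nat) n.

Lemma is_series_shift {K : AbsRing} {V : NormedModule K} (f : nat -> V) (l : V) (n : nat) :
  is_series f l ->
  is_series (fun m => if le_dec n m then f (m - n)%nat else zero) l.
Proof.
  intros H. induction n as [|n IH].
  - eapply is_series_ext; [|exact H]. intros m. simpl.
    destruct (le_dec 0 m); [now rewrite Nat.sub_0_r|lia].
  - apply is_series_decr_1.
    replace (plus l _) with l.
    + eapply is_series_ext; [|exact IH]. intros m. simpl.
      destruct (le_dec n m), (le_dec (S n) (S m)); try lia; reflexivity.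
    + destruct (le_dec (S n) 0); [lia|].
      transitivity (plus l zero).
      * symmetry. exact (plus_zero_r l).
      * f_equal. symmetry. exact (opp_zero (G := NormedModule.AbelianGroup K V)).
Qed.

(** Fubini for the array [u n * v (m - n) * z ^ m], [n <= m]: its rows sum to
    [u n * z ^ n * g z], and its columns to the Cauchy product. *)
Lemma ps_on_mult r u v f g :
  ps_on r u f -> ps_on r v g -> ps_on r (conv u v) (fun z => f z * g z).
Proof.
  intros Hu Hv. apply ps_on_intro. intros z Hz.
  set (rho := Cmod z). assert (H0 := Cmod_ge_0 z). fold rho in H0, Hz.
  destruct (ps_on_abs r v g rho Hv ltac:(lra)) as [VB HVB].
  destruct (fubini_series
    (fun n m => u n * z ^ n * (if le_dec n m then v (m - n)%nat * z ^ (m - n) else 0))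
    (fun n m => Cmod (u n) * rho ^ n *
       (if le_dec n m then Cmod (v (m - n)%nat) * rho ^ (m - n) else 0))%R
    (fun n => Cmod (u n) * rho ^ n * VB)%R
    (fun n => u n * z ^ n * g z) (f z * g z)) as [c [Hc Hs]].
  - intros n m. rewrite !Cmod_mult, Cmod_pow. fold rho. right. f_equal.
    destruct (le_dec n m); [now rewrite Cmod_mult, Cmod_pow|apply Cmod_0].
  - intros n. apply (is_series_scal (V := R_NormedModule)).
    exact (is_series_shift (V := R_NormedModule) _ _ n HVB).
  - apply (ex_series_ext (fun n => VB * (Cmod (u n) * rho ^ n))%R); [intros; simpl; ring|].
    apply (ex_series_scal_l (V := R_NormedModule)). apply (ps_on_abs r u f); [assumption|lra].
  - intros n. apply is_series_C_scal.
    exact (is_series_shift (V := C_NormedModule) _ _ n (ps_on_series r v g z Hv Hz)).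
  - rewrite (Cmult_comm (f z)).
    eapply is_series_ext; [|apply (is_series_C_scal (g z) _ _ (ps_on_series r u f z Hu Hz))].
    intros n. simpl. ring.
  - eapply is_series_ext; [|exact Hs]. intros m. simpl.
    apply (is_series_C_unique _ _ _ (Hc m)).
    replace (conv u v m * z ^ m) with
      (sum_n (fun n => u n * z ^ n * (if le_dec n m then v (m - n)%nat * z ^ (m - n) else 0)) m).
    + apply (is_series_finite (V := C_NormedModule)
        (fun n => u n * z ^ n * (if le_dec n m then v (m - n)%nat * z ^ (m - n) else 0)) m).
      intros k Hk. destruct (le_dec k m); [lia|].
      change (u k * z ^ k * 0 = 0). ring.
    + unfold conv. rewrite Cmult_comm.
      rewrite <- (sum_n_mult_l (K := C_Ring) (z ^ m)). apply sum_n_ext_loc.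
      intros k Hk. destruct (le_dec k m); [|lia].
      change (u k * z ^ k * (v (m - k)%nat * z ^ (m - k)) = z ^ m * (u k * v (m - k)%nat)).
      replace (z ^ m) with (z ^ k * z ^ (m - k)); [ring|].
      rewrite <- Cpow_add_r. f_equal. lia.
Qed.

(** * Composition of power series *)

(** Coefficients of the n-th power of a power series. *)
Fixpoint conv_pow (v : nat -> C) (n : nat) : nat -> C :=
  match n with
  | O => fun m => match m with O => RtoC 1 | _ => RtoC 0 end
  | S n' => conv v (conv_pow v n')
  end.

Lemma ps_on_pow r v g n : ps_on r v g -> ps_on r (conv_pow v n) (fun z => g z ^ n).
Proof.
  intros H. induction n as [|n IH]; [exact (ps_on_const r 1)|].
  exact (ps_on_mult r _ _ _ _ H IH).
Qed.

(** Cauchy products are dominated termwise by the Cauchy products of the absolute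
    values, and these multiply as series of nonnegative reals. *)
Lemma conv_pow_majorant (v : nat -> C) (rho V : R) :
  0 <= rho -> is_series (fun m => Cmod (v m) * rho ^ m)%R V ->
  forall n, exists B : nat -> R,
    is_series B (V ^ n)%R /\ forall m, Cmod (conv_pow v n m) * rho ^ m <= B m.
Proof.
  intros Hrho HV n.
  assert (Hnn : forall w : nat -> C, forall m, 0 <= (Cmod (w m) * rho ^ m)%R).
  { intros w m. apply Rmult_le_pos; [apply Cmod_ge_0|now apply pow_le]. }
  induction n as [|n [B [HB HBle]]].
  - exists (fun m => match m with O => 1%R | _ => 0%R end). split.
    + pose (t := fun m : nat => match m with O => 1%R | _ => 0%R end).
      assert (E : sum_n t 0 = 1%R) by (now rewrite sum_O).
      change (is_series t 1%R). rewrite <- E.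
      apply (is_series_finite (V := R_NormedModule) t 0).
      intros [|k] Hk; [lia|reflexivity].
    + intros [|m]; simpl.
      * rewrite Cmod_1. lra.
      * rewrite Cmod_0. lra.
  - exists (fun m => sum_f_R0 (fun k => (Cmod (v k) * rho ^ k) * B (m - k)%nat)%R m). split.
    + simpl. apply is_series_mult_pos; [assumption|assumption|apply Hnn|].
      intros m. eapply Rle_trans; [apply Hnn|apply HBle].
    + intros m. simpl. rewrite <- sum_n_Reals.
      eapply Rle_trans.
      * apply Rmult_le_compat_r; [now apply pow_le|].
        unfold conv. apply (Cmod_sum_n _ (fun k => Cmod (v k) * Cmod (conv_pow v n (m - k)))%R).
        intros k Hk. rewrite Cmod_mult. lra.
      * rewrite Rmult_comm.
        rewrite <- (sum_n_mult_l (K := R_Ring) (rho ^ m)%R).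
        apply sum_n_le_R. intros k Hk.
        change (rho ^ m * (Cmod (v k) * Cmod (conv_pow v n (m - k)))
          <= Cmod (v k) * rho ^ k * B (m - k)%nat).
        replace (rho ^ m)%R with (rho ^ k * rho ^ (m - k))%R
          by (rewrite <- pow_add; f_equal; lia).
        replace (rho ^ k * rho ^ (m - k) * (Cmod (v k) * Cmod (conv_pow v n (m - k))))%R
          with (Cmod (v k) * rho ^ k * (Cmod (conv_pow v n (m - k)) * rho ^ (m - k)))%R by ring.
        apply Rmult_le_compat_l; [apply Hnn|apply HBle].
Qed.

(** Fubini for the array [u n * conv_pow v n m * z ^ m]. The constant term of [g] may be
    nonzero, so that the new coefficients are infinite sums; with [g h = z0 + h] this
    covers recentring. *)
Lemma ps_on_comp r s u v f g (rho V : R) :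
  ps_on r u f -> ps_on s v g -> 0 < rho < s ->
  is_series (fun m => Cmod (v m) * rho ^ m)%R V -> V < r ->
  exists e, ps_on rho e (fun z => f (g z)) /\
    forall m, C_series (fun n => u n * conv_pow v n m) (e m).
Proof.
  intros Hu Hv Hrho HV HVr.
  destruct (functional_choice _ (conv_pow_majorant v rho V ltac:(lra) HV)) as [B HB].
  assert (HV0 : 0 <= V).
  { eapply Rle_trans; [|apply (sum_n_le_series _ _ 0 (fun k =>
      Rmult_le_pos _ _ (Cmod_ge_0 (v k)) (pow_le rho k ltac:(lra))) HV)].
    rewrite sum_O. apply Rmult_le_pos; [apply Cmod_ge_0|apply pow_le; lra]. }
  assert (HF : forall z, Cmod z <= rho -> exists c,
    (forall m, C_series (fun n => u n * conv_pow v n m * z ^ m) (c m)) /\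
    C_series c (f (g z))).
  { intros z Hz.
    apply (fubini_series (fun n m => u n * conv_pow v n m * z ^ m)
             (fun n m => Cmod (u n) * B n m)%R (fun n => Cmod (u n) * V ^ n)%R
             (fun n => u n * g z ^ n)).
    - intros n m. rewrite !Cmod_mult, Cmod_pow, Rmult_assoc.
      apply Rmult_le_compat_l; [apply Cmod_ge_0|].
      eapply Rle_trans; [|apply HB].
      apply Rmult_le_compat_l; [apply Cmod_ge_0|].
      apply pow_incr. split; [apply Cmod_ge_0|assumption].
    - intros n. apply (is_series_scal (V := R_NormedModule)). apply HB.
    - apply (ps_on_abs r u f); [assumption|lra].
    - intros n.
      eapply is_series_ext; [|apply (is_series_C_scal (u n) _ _
        (ps_on_series s _ _ z (ps_on_pow s v g n Hv) ltac:(lra)))].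
      intros m. simpl. ring.
    - apply (ps_on_series r); [assumption|].
      apply Rle_lt_trans with V; [|assumption].
      apply (is_series_C_norm_le _ _ _ _ (ps_on_series s v g z Hv ltac:(lra))) with (2 := HV).
      intros n. rewrite Cmod_mult, Cmod_pow.
      apply Rmult_le_compat_l; [apply Cmod_ge_0|].
      apply pow_incr. split; [apply Cmod_ge_0|assumption]. }
  destruct (HF (RtoC rho)) as [c [Hc _]]; [rewrite Cmod_nonneg_real; lra|].
  assert (Hrho0 : forall m, RtoC rho ^ m <> 0).
  { intros m. apply Cpow_nz. intros E. apply RtoC_inj in E. lra. }
  assert (He : forall m, C_series (fun n => u n * conv_pow v n m) (/ RtoC rho ^ m * c m)).
  { intros m. eapply is_series_ext; [|apply (is_series_C_scal (/ RtoC rho ^ m) _ _ (Hc m))].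
    intros n. simpl. field. apply Hrho0. }
  exists (fun m => / RtoC rho ^ m * c m). split; [|assumption].
  apply ps_on_intro. intros z Hz.
  destruct (HF z) as [c' [Hc' Hs]]; [lra|].
  eapply is_series_ext; [|exact Hs].
  intros m. simpl. apply (is_series_C_unique _ _ _ (Hc' m)).
  rewrite (Cmult_comm _ (z ^ m)).
  eapply is_series_ext; [|apply (is_series_C_scal (z ^ m) _ _ (He m))].
  intros n. simpl. ring.
Qed.

(** * Recentring and differentiating power series *)

(** Coefficients of the translation [h |-> z0 + h]. *)
Definition translation_coef (z0 : C) (m : nat) : C :=
  match m with O => z0 | 1%nat => RtoC 1 | _ => RtoC 0 end.

Lemma ps_on_translation r z0 : ps_on r (translation_coef z0) (fun h => z0 + h).
Proof.
  apply ps_on_intro. intros h Hh.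
  pose (t := fun m => translation_coef z0 m * h ^ m).
  assert (E : sum_n t 1 = z0 + h).
  { rewrite sum_Sn, sum_O. unfold t. simpl.
    change (z0 * 1 + 1 * (h * 1) = z0 + h). ring. }
  change (C_series t (z0 + h)). rewrite <- E.
  apply (is_series_finite (V := C_NormedModule) t 1).
  intros [|[|k]] Hk; [lia|lia|]. change (0 * h ^ S (S k) = 0). ring.
Qed.

Lemma conv_pow_translation z0 n :
  conv_pow (translation_coef z0) n 0%nat = z0 ^ n /\
  conv_pow (translation_coef z0) (S n) 1%nat = INR (S n) * z0 ^ n.
Proof.
  assert (H0 : forall k, conv_pow (translation_coef z0) k 0%nat = z0 ^ k).
  { induction k as [|k IH]; [reflexivity|]. simpl. unfold conv. rewrite sum_O.
    change (translation_coef z0 0 * conv_pow (translation_coef z0) k 0%nat = z0 * z0 ^ k).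
    now rewrite IH. }
  split; [apply H0|].
  induction n as [|n IH].
  - change (sum_n (fun k => translation_coef z0 k
      * conv_pow (translation_coef z0) 0 (1 - k)%nat) 1 = INR 1 * z0 ^ 0).
    rewrite sum_Sn, sum_O.
    change (z0 * 0 + 1 * 1 = 1 * 1). ring.
  - change (sum_n (fun k => translation_coef z0 k
      * conv_pow (translation_coef z0) (S n) (1 - k)%nat) 1 = INR (S (S n)) * z0 ^ S n).
    rewrite sum_Sn, sum_O.
    change (z0 * conv_pow (translation_coef z0) (S n) 1%nat
      + 1 * conv_pow (translation_coef z0) (S n) 0%nat = INR (S (S n)) * z0 ^ S n).
    rewrite IH, H0, (S_INR (S n)), RtoC_plus. simpl. ring.
Qed.

(** The coefficient of index 1 is singled out because it is the derivative at [z0],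
    here as the sum of the differentiated series. *)
Lemma ps_on_recentre r u f z0 :
  ps_on r u f -> Cmod z0 < r ->
  exists rho v, 0 < rho /\ ps_on rho v (fun h => f (z0 + h)) /\
    C_series (fun k => INR (S k) * u (S k) * z0 ^ k) (v 1%nat).
Proof.
  intros Hu Hz.
  set (rho := ((r - Cmod z0) / 2)%R).
  assert (Hrho : 0 < rho) by (unfold rho; lra).
  destruct (ps_on_comp r (rho + 1) u (translation_coef z0) f (fun h => z0 + h) rho
    (Cmod z0 + rho)) as [v [Hv Hc]]; try assumption.
  - apply ps_on_translation.
  - lra.
  - pose (t := fun m => (Cmod (translation_coef z0 m) * rho ^ m)%R).
    assert (E : sum_n t 1 = (Cmod z0 + rho)%R).
    { rewrite sum_Sn, sum_O. unfold t. simpl. rewrite Cmod_1.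
      change (Cmod z0 * 1 + 1 * (rho * 1) = Cmod z0 + rho)%R. ring. }
    change (is_series t (Cmod z0 + rho)%R). rewrite <- E.
    apply (is_series_finite (V := R_NormedModule) t 1).
    intros [|[|k]] Hk; [lia|lia|]. unfold t. simpl translation_coef.
    rewrite Cmod_0. exact (Rmult_0_l _).
  - unfold rho. lra.
  - exists rho, v. repeat split; [assumption|assumption|].
    assert (Hs := is_series_incr_1 (V := C_NormedModule)
      (fun n => u n * conv_pow (translation_coef z0) n 1%nat) (v 1%nat)).
    apply (is_series_ext (fun k => u (S k) * conv_pow (translation_coef z0) (S k) 1%nat)).
    + intros k. rewrite (proj2 (conv_pow_translation z0 k)).
      change (u (S k) * (INR (S k) * z0 ^ k) = INR (S k) * u (S k) * z0 ^ k). ring.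
    + apply Hs.
      change (C_series (fun n => u n * conv_pow (translation_coef z0) n 1%nat)
                (v 1%nat + u 0%nat * 0)).
      replace (v 1%nat + u 0%nat * 0) with (v 1%nat) by ring. apply Hc.
Qed.

Definition deriv_coef (u : nat -> C) (k : nat) : C := INR (S k) * u (S k).

Lemma is_derive_C_translate f z0 l :
  C_is_derive (fun h => f (z0 + h)) (RtoC 0) l -> C_is_derive f z0 l.
Proof.
  intros H. apply is_derive_C_eps. intros eps Heps.
  destruct (proj1 (is_derive_C_eps _ _ _) H eps Heps) as [d [Hd H']].
  exists d. split; [assumption|]. intros h Hh. specialize (H' h Hh).
  now rewrite Cplus_0_l, Cplus_0_r in H'.
Qed.

Lemma ps_on_derive r u f :
  ps_on r u f ->
  ps_on r (deriv_coef u) (C_derive f) /\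
  forall z, Cmod z < r -> C_is_derive f z (C_derive f z).
Proof.
  intros Hu.
  assert (H : forall z, Cmod z < r ->
    C_is_derive f z (C_derive f z) /\
    C_series (fun k => deriv_coef u k * z ^ k) (C_derive f z)).
  { intros z Hz. destruct (ps_on_recentre r u f z Hu Hz) as [rho [v [Hrho [Hv Hs]]]].
    assert (Hd := is_derive_C_translate f z _ (ps_on_derive_0 _ _ _ Hrho Hv)).
    rewrite (is_C_derive_unique f z _ Hd). now split. }
  split; [|intros z Hz; now apply H].
  apply ps_on_intro. intros z Hz. now apply H.
Qed.

(** * Analytic functions *)

Lemma analytic_at_ps f z0 :
  analytic_at f z0 <-> exists u r, 0 < r /\ ps_on r u (fun h => f (z0 + h)).
Proof.
  split; intros [u [r [Hr H]]]; exists u, r; (split; [assumption|]).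
  - intros h Hh. specialize (H (z0 + h)). replace (z0 + h - z0) with h in H by ring.
    now apply H.
  - intros z Hz. specialize (H (z - z0) Hz). cbv beta in H.
    now replace (z0 + (z - z0)) with z in H by ring.
Qed.

Lemma ps_on_analytic r u f z0 : ps_on r u f -> Cmod z0 < r -> analytic_at f z0.
Proof.
  intros H Hz. apply analytic_at_ps.
  destruct (ps_on_recentre r u f z0 H Hz) as [rho [v [Hrho [Hv _]]]].
  now exists v, rho.
Qed.

Lemma analytic_at_ext f g z0 d :
  0 < d -> (forall z, Cmod (z - z0) < d -> f z = g z) -> analytic_at f z0 -> analytic_at g z0.
Proof.
  intros Hd Hfg [u [r [Hr H]]]. exists u, (Rmin r d).
  split; [now apply Rmin_glb_lt|]. intros z Hz.
  rewrite <- Hfg by (eapply Rlt_le_trans; [exact Hz|apply Rmin_r]).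
  apply H. eapply Rlt_le_trans; [exact Hz|apply Rmin_l].
Qed.

Lemma analytic_at_minus f g z0 :
  analytic_at f z0 -> analytic_at g z0 -> analytic_at (fun z => f z - g z) z0.
Proof.
  intros Hf Hg. apply analytic_at_ps in Hf. apply analytic_at_ps in Hg. apply analytic_at_ps.
  destruct Hf as [u [r [Hr Hu]]], Hg as [v [s [Hs Hv]]].
  exists (fun k => u k + (- (1)) * v k), (Rmin r s). split; [now apply Rmin_glb_lt|].
  eapply ps_on_ext with (u := fun k => u k + (- (1)) * v k)
    (f := fun h => f (z0 + h) + (- (1)) * g (z0 + h)); [reflexivity|intros; ring|].
  apply ps_on_plus.
  - now apply (ps_on_mono r); [apply Rmin_l|].
  - apply ps_on_scal. now apply (ps_on_mono s); [apply Rmin_r|].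
Qed.

Lemma analytic_at_scal c f z0 : analytic_at f z0 -> analytic_at (fun z => c * f z) z0.
Proof.
  intros Hf. apply analytic_at_ps in Hf. apply analytic_at_ps.
  destruct Hf as [u [r [Hr Hu]]]. exists (fun k => c * u k), r.
  split; [assumption|]. exact (ps_on_scal r c _ _ Hu).
Qed.

Lemma analytic_at_translation a z0 : analytic_at (fun z => a + z) z0.
Proof.
  apply analytic_at_ps. exists (translation_coef (a + z0)), 1%R. split; [lra|].
  eapply ps_on_ext; [reflexivity| |apply ps_on_translation].
  intros h _. simpl. ring.
Qed.

Lemma analytic_at_continuous f z0 :
  analytic_at f z0 ->
  forall eps, 0 < eps -> exists d, 0 < d /\ forall z, Cmod (z - z0) < d -> Cmod (f z - f z0) < eps.
Proof.
  intros Hf eps Heps. apply analytic_at_ps in Hf. destruct Hf as [u [r [Hr H]]].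
  destruct (ps_on_tail r u _ H) as [g [Hg Hfg]].
  destruct (ps_on_bounded r _ g (r / 2) Hg ltac:(lra)) as [M [HM0 HM]].
  exists (Rmin (r / 2) (eps / (M + 1))). split.
  { apply Rmin_glb_lt; [lra|]. apply Rdiv_lt_0_compat; lra. }
  intros z Hz.
  assert (H1 := Rlt_le_trans _ _ _ Hz (Rmin_l _ _)).
  assert (H2 := Rlt_le_trans _ _ _ Hz (Rmin_r _ _)).
  assert (E0 := ps_on_at_0 r u _ Hr H). cbv beta in E0. rewrite Cplus_0_r in E0.
  specialize (Hfg (z - z0) ltac:(lra)). replace (z0 + (z - z0)) with z in Hfg by ring.
  rewrite Hfg, E0. replace (u 0%nat + (z - z0) * g (z - z0) - u 0%nat)
    with ((z - z0) * g (z - z0)) by ring.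
  rewrite Cmod_mult. apply Rlt_div_r in H2; [|lra].
  specialize (HM (z - z0) ltac:(lra)).
  pose proof (Cmod_ge_0 (z - z0)). pose proof (Cmod_ge_0 (g (z - z0))). nra.
Qed.

(** Without constant term the majorant at [t * s / 2] is at most [t] times the one
    at [s / 2]. *)
Lemma ps_on_small_majorant s v f r :
  ps_on s v f -> v 0%nat = 0 -> 0 < s -> 0 < r ->
  exists rho V, 0 < rho < s /\ is_series (fun m => Cmod (v m) * rho ^ m)%R V /\ V < r.
Proof.
  intros Hv Hv0 Hs Hr.
  assert (Ha := ps_on_abs s v f (s / 2) Hv ltac:(lra)).
  set (b := fun m => (Cmod (v m) * (s / 2) ^ m)%R) in Ha.
  set (M := Series b).
  assert (Hb0 : forall m, 0 <= b m).
  { intros m. apply Rmult_le_pos; [apply Cmod_ge_0|apply pow_le; lra]. }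
  assert (HM : 0 <= M).
  { eapply Rle_trans; [apply (Hb0 0%nat)|].
    pose proof (sum_n_le_series b M 0 Hb0 (Series_correct _ Ha)) as H.
    now rewrite sum_O in H. }
  set (t := Rmin 1 (r / (M + 1))).
  assert (Ht : 0 < t) by (apply Rmin_glb_lt; [lra|apply Rdiv_lt_0_compat; lra]).
  assert (Ht1 : t <= 1) by apply Rmin_l.
  assert (Ht2 : t <= r / (M + 1)) by apply Rmin_r.
  set (rho := (t * (s / 2))%R).
  assert (Hrho : 0 < rho < s) by (unfold rho; nra).
  assert (Hex := ps_on_abs s v f rho Hv ltac:(lra)).
  exists rho, (Series (fun m => Cmod (v m) * rho ^ m)%R).
  repeat split; try lra; [now apply Series_correct|].
  apply Rle_lt_trans with (Series (fun m => t * b m)%R).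
  - apply Series_le; [|now apply (ex_series_scal_l (V := R_NormedModule))].
    intros m. split.
    + apply Rmult_le_pos; [apply Cmod_ge_0|apply pow_le; lra].
    + unfold b. destruct m as [|m].
      * rewrite Hv0, Cmod_0. lra.
      * unfold rho. rewrite Rpow_mult_distr.
        replace (t * (Cmod (v (S m)) * (s / 2) ^ S m))%R
          with (Cmod (v (S m)) * (t * (s / 2) ^ S m))%R by ring.
        apply Rmult_le_compat_l; [apply Cmod_ge_0|].
        apply Rmult_le_compat_r; [apply pow_le; lra|].
        simpl. rewrite <- (Rmult_1_r t) at 3.
        apply Rmult_le_compat_l; [lra|]. rewrite <- (pow1 m). apply pow_incr. lra.
  - rewrite Series_scal_l. fold M.
    apply Rle_lt_trans with (r / (M + 1) * M)%R; [apply Rmult_le_compat_r; lra|].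
    replace (r / (M + 1) * M)%R with (r * (M / (M + 1)))%R by (field; lra).
    rewrite <- (Rmult_1_r r) at 2. apply Rmult_lt_compat_l; [assumption|].
    apply Rlt_div_l; lra.
Qed.

Lemma analytic_at_comp f g z0 :
  analytic_at f (g z0) -> analytic_at g z0 -> analytic_at (fun z => f (g z)) z0.
Proof.
  intros Hf Hg. apply analytic_at_ps in Hf. apply analytic_at_ps in Hg. apply analytic_at_ps.
  destruct Hf as [u [r [Hr Hu]]], Hg as [v [s [Hs Hv]]].
  pose (v' := fun m => v m + (match m with O => - g z0 | _ => RtoC 0 end)).
  assert (Hv' : ps_on s v' (fun h => g (z0 + h) + (- g z0))).
  { exact (ps_on_plus s _ _ _ _ Hv (ps_on_const s (- g z0))). }
  assert (E0 := ps_on_at_0 s v _ Hs Hv). cbv beta in E0. rewrite Cplus_0_r in E0.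
  destruct (ps_on_small_majorant s v' _ r Hv') as [rho [V [Hrho [HV HVr]]]]; try assumption.
  { unfold v'. rewrite E0. ring. }
  destruct (ps_on_comp r s u v' _ _ rho V Hu Hv' Hrho HV HVr) as [e [He _]].
  exists e, rho. split; [lra|].
  eapply ps_on_ext; [reflexivity| |exact He].
  intros h _. simpl. f_equal. ring.
Qed.

(** * The identity theorem along rays *)

Lemma analytic_at_zeros f z0 :
  analytic_at f z0 ->
  (forall d, 0 < d -> exists h : C, h <> 0 /\ Cmod h < d /\ f (z0 + h) = 0) ->
  exists d, 0 < d /\ forall h, Cmod h < d -> f (z0 + h) = 0.
Proof.
  intros Hf Hz. apply analytic_at_ps in Hf. destruct Hf as [u [r [Hr H]]].
  assert (Hu := ps_on_zero r u _ Hr H Hz).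
  exists r. split; [assumption|]. intros h Hh.
  apply (is_series_C_unique _ _ _ (ps_on_series _ _ _ _ H Hh)).
  apply (is_series_ext (fun k => match k with O => RtoC 0 | _ => 0 end * h ^ k)).
  - intros [|k]; now rewrite Hu.
  - exact (ps_on_series r _ _ h (ps_on_const r 0) Hh).
Qed.

(** The set of [t] such that [f] vanishes near every [s x], [s <= t], is open by
    definition, and closed because its supremum is an accumulation point of zeros. *)
Lemma identity_theorem_zero f x :
  (forall t, 0 <= t <= 1 -> analytic_at f (RtoC t * x)) ->
  (exists d, 0 < d /\ forall z, Cmod z < d -> f z = 0) ->
  f x = 0.
Proof.
  intros Hf [d0 [Hd0 Hnear]].
  destruct (excluded_middle_informative (x = 0)) as [->|Hx].
  { apply Hnear. now rewrite Cmod_0. }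
  assert (Hmx : 0 < Cmod x) by now apply Cmod_gt_0.
  pose (P := fun t : R => exists d, 0 < d /\ forall h, Cmod h < d -> f (RtoC t * x + h) = 0).
  pose (E := fun t : R => 0 <= t <= 1 /\ forall s, 0 <= s <= t -> P s).
  assert (HP0 : P 0%R).
  { exists d0. split; [assumption|]. intros h Hh. apply Hnear.
    now replace (RtoC 0 * x + h) with h by ring. }
  assert (HE0 : E 0%R).
  { split; [lra|]. intros s Hs. now replace s with 0%R by lra. }
  destruct (completeness E) as [T [HT1 HT2]].
  { exists 1%R. intros t [Ht _]. lra. }
  { now exists 0%R. }
  assert (HT01 : 0 <= T <= 1).
  { split; [now apply HT1|]. apply HT2. intros t [Ht _]. lra. }
  assert (Hbelow : forall s, 0 <= s < T -> P s).
  { intros s Hs. destruct (classic (exists t, E t /\ s < t)) as [[t [[_ Ht] Hst]]|Hn].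
    - apply Ht. lra.
    - exfalso. apply (Rlt_not_le T s); [lra|]. apply HT2. intros t Ht.
      apply Rnot_lt_le. intros Hlt. apply Hn. now exists t. }
  assert (HPT : P T).
  { destruct (Req_dec T 0) as [->|HT0]; [assumption|].
    apply analytic_at_zeros; [now apply Hf|].
    intros d Hd.
    set (del := Rmin T (d / (2 * Cmod x))).
    assert (Hdel : 0 < del).
    { apply Rmin_glb_lt; [lra|]. apply Rdiv_lt_0_compat; lra. }
    assert (H1 : del <= T) by apply Rmin_l.
    assert (H2 : del <= d / (2 * Cmod x)) by apply Rmin_r.
    exists (RtoC (- del) * x). repeat split.
    - apply Cmult_neq_0; [|assumption]. intros H. apply RtoC_inj in H. lra.
    - rewrite Cmod_mult, Cmod_R, Rabs_Ropp, Rabs_pos_eq by lra.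
      apply Rle_div_r in H2; lra.
    - destruct (Hbelow (T - del)%R ltac:(lra)) as [e [He H]].
      specialize (H 0). rewrite Cmod_0, Cplus_0_r, RtoC_minus in H. specialize (H He).
      replace (RtoC T * x + RtoC (- del) * x) with ((RtoC T - RtoC del) * x); [exact H|].
      rewrite RtoC_opp. ring. }
  destruct HPT as [d [Hd Hvan]].
  destruct (Req_dec T 1) as [->|HT1'].
  { specialize (Hvan 0). rewrite Cmod_0, Cplus_0_r, Cmult_1_l in Hvan. now apply Hvan. }
  exfalso.
  set (del := Rmin (1 - T) (d / (2 * Cmod x))).
  assert (Hdel : 0 < del).
  { apply Rmin_glb_lt; [lra|]. apply Rdiv_lt_0_compat; lra. }
  assert (H1 : del <= 1 - T) by apply Rmin_l.
  assert (H2 : del <= d / (2 * Cmod x)) by apply Rmin_r.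
  apply Rle_div_r in H2; [|lra].
  assert (Hmem : E (T + del)%R).
  { split; [lra|]. intros s Hs. destruct (Rlt_dec s T) as [Hst|Hst]; [apply Hbelow; lra|].
    assert (Hm : Cmod (RtoC (s - T) * x) <= d / 2).
    { rewrite Cmod_mult, Cmod_R, Rabs_pos_eq by lra.
      apply Rle_trans with (del * Cmod x)%R; [apply Rmult_le_compat_r; lra|lra]. }
    exists (d / 2)%R. split; [lra|]. intros h Hh.
    replace (RtoC s * x + h) with (RtoC T * x + (RtoC (s - T) * x + h))
      by (rewrite RtoC_minus; ring).
    apply Hvan. eapply Rle_lt_trans; [apply Cmod_triangle|]. lra. }
  specialize (HT1 _ Hmem). lra.
Qed.

Lemma identity_theorem f g x :
  (forall t, 0 <= t <= 1 -> analytic_at f (RtoC t * x)) ->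
  (forall t, 0 <= t <= 1 -> analytic_at g (RtoC t * x)) ->
  (exists d, 0 < d /\ forall z, Cmod z < d -> f z = g z) ->
  f x = g x.
Proof.
  intros Hf Hg [d [Hd Hfg]].
  assert (H : f x - g x = 0).
  { apply (identity_theorem_zero (fun z => f z - g z)).
    - intros t Ht. apply analytic_at_minus; auto.
    - exists d. split; [assumption|]. intros z Hz. rewrite Hfg by assumption. ring. }
  replace (f x) with (f x - g x + g x) by ring. rewrite H. ring.
Qed.

(** * Power series solutions of Fuchsian equations *)

Definition theta (u : nat -> C) (k : nat) : C := INR k * u k.

(** Coefficients of [z P f' + Q f]. *)
Definition lower_order (p q u : nat -> C) (k : nat) : C := conv p (theta u) k + conv q u k.

(** Coefficients of [z f'' + (c + z P) f' + Q f]. *)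
Definition fuchs (c : C) (p q u : nat -> C) (k : nat) : C :=
  INR (S k) * (INR k + c) * u (S k) + lower_order p q u k.

(* [sum_n] and [is_series] leave the operations and the equality of the algebraic
   hierarchy in the goal. *)
Ltac C_ring :=
  change (@plus _) with Cplus; change (@mult _) with Cmult;
  match goal with |- @eq _ ?a ?b => change (@eq C a b) end; ring.

Lemma conv_ext_le u v u' v' k :
  (forall j, (j <= k)%nat -> u j = u' j) -> (forall j, (j <= k)%nat -> v j = v' j) ->
  conv u v k = conv u' v' k.
Proof.
  intros Hu Hv. apply sum_n_ext_loc. intros j Hj. rewrite Hu, Hv by lia. reflexivity.
Qed.

Lemma conv_plus_l u u' v k : conv (fun n => u n + u' n) v k = conv u v k + conv u' v k.
Proof.
  unfold conv. rewrite <- (sum_n_plus (G := C_AbelianMonoid)).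
  apply sum_n_ext. intros j. C_ring.
Qed.

Lemma conv_plus_r u v v' k : conv u (fun n => v n + v' n) k = conv u v k + conv u v' k.
Proof.
  unfold conv. rewrite <- (sum_n_plus (G := C_AbelianMonoid)).
  apply sum_n_ext. intros j. C_ring.
Qed.

Lemma conv_scal_l c u v k : conv (fun n => c * u n) v k = c * conv u v k.
Proof.
  unfold conv. rewrite <- (sum_n_mult_l (K := C_Ring)).
  apply sum_n_ext. intros j. C_ring.
Qed.

Lemma conv_scal_r c u v k : conv u (fun n => c * v n) k = c * conv u v k.
Proof.
  unfold conv. rewrite <- (sum_n_mult_l (K := C_Ring)).
  apply sum_n_ext. intros j. C_ring.
Qed.

Lemma lower_order_ext p q u p' q' u' k :
  (forall j, p j = p' j) -> (forall j, q j = q' j) -> (forall j, (j <= k)%nat -> u j = u' j) ->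
  lower_order p q u k = lower_order p' q' u' k.
Proof.
  intros Hp Hq Hu. unfold lower_order, theta.
  f_equal; apply conv_ext_le; intros j Hj; rewrite ?Hp, ?Hq, ?Hu by lia; reflexivity.
Qed.

Lemma lower_order_plus_u p q u v k :
  lower_order p q (fun n => u n + v n) k = lower_order p q u k + lower_order p q v k.
Proof.
  unfold lower_order. rewrite conv_plus_r.
  rewrite (conv_ext_le p (theta (fun n => u n + v n)) p (fun n => theta u n + theta v n))
    by (intros; unfold theta; ring).
  rewrite conv_plus_r. ring.
Qed.

Lemma lower_order_scal_u p q c u k :
  lower_order p q (fun n => c * u n) k = c * lower_order p q u k.
Proof.
  unfold lower_order. rewrite conv_scal_r.
  rewrite (conv_ext_le p (theta (fun n => c * u n)) p (fun n => c * theta u n))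
    by (intros; unfold theta; ring).
  rewrite conv_scal_r. ring.
Qed.

Lemma lower_order_plus_pq p q p' q' u k :
  lower_order (fun n => p n + p' n) (fun n => q n + q' n) u k
  = lower_order p q u k + lower_order p' q' u k.
Proof. unfold lower_order. rewrite !conv_plus_l. ring. Qed.

Lemma lower_order_scal_pq p q c u k :
  lower_order (fun n => c * p n) (fun n => c * q n) u k = c * lower_order p q u k.
Proof. unfold lower_order. rewrite !conv_scal_l. ring. Qed.

Lemma fuchs_plus_u c p q u v k :
  fuchs c p q (fun n => u n + v n) k = fuchs c p q u k + fuchs c p q v k.
Proof. unfold fuchs. rewrite lower_order_plus_u. ring. Qed.

Lemma fuchs_scal_u c p q a u k :
  fuchs c p q (fun n => a * u n) k = a * fuchs c p q u k.
Proof. unfold fuchs. rewrite lower_order_scal_u. ring. Qed.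

Lemma INR_S_neq_0 k : RtoC (INR (S k)) <> 0.
Proof. intros H. apply RtoC_inj in H. apply (not_0_INR (S k)); [lia|assumption]. Qed.

Lemma fuchs_unique c p q u v :
  (forall k, INR k + c <> 0) -> u 0%nat = v 0%nat ->
  (forall k, fuchs c p q u k = fuchs c p q v k) -> forall k, u k = v k.
Proof.
  intros Hc H0 H.
  assert (Hs : forall n k, (k <= n)%nat -> u k = v k).
  { induction n as [|n IH]; intros k Hk; [now replace k with 0%nat by lia|].
    destruct (Nat.eq_dec k (S n)) as [->|Hne]; [|apply IH; lia].
    specialize (H n). unfold fuchs in H.
    rewrite (lower_order_ext p q u p q v) in H by auto.
    assert (E : INR (S n) * (INR n + c) * u (S n) = INR (S n) * (INR n + c) * v (S n)).
    { set (w := lower_order p q v n) in *.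
      replace (INR (S n) * (INR n + c) * u (S n))
        with (INR (S n) * (INR n + c) * u (S n) + w - w) by ring.
      rewrite H. ring. }
    assert (Hn : INR (S n) * (INR n + c) <> 0)
      by (apply Cmult_neq_0; [apply INR_S_neq_0|apply Hc]).
    replace (u (S n)) with (/ (INR (S n) * (INR n + c)) * (INR (S n) * (INR n + c) * u (S n)))
      by (field; split; [apply Hc|apply INR_S_neq_0]).
    rewrite E. field; split; [apply Hc|apply INR_S_neq_0]. }
  intros k. now apply (Hs k).
Qed.

(** The recurrence uses all earlier terms, so the recursion builds whole prefixes:
    [fuchs_prefix n] is right up to index [n] and meaningless beyond. *)
Fixpoint fuchs_prefix (c : C) (p q s : nat -> C) (u0 : C) (n : nat) : nat -> C :=
  match n with
  | O => fun _ => u0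
  | S k => fun i =>
      if le_dec i k then fuchs_prefix c p q s u0 k i
      else (s k - lower_order p q (fuchs_prefix c p q s u0 k) k) / (INR (S k) * (INR k + c))
  end.

Definition fuchs_solution c p q s u0 (n : nat) : C := fuchs_prefix c p q s u0 n n.

(** [lower_order] at [k] involves only the indices up to [k], so the recurrence can
    be solved step by step as long as [k + c] does not vanish. *)
Lemma fuchs_solution_spec c p q s u0 :
  (forall k, INR k + c <> 0) -> forall k, fuchs c p q (fuchs_solution c p q s u0) k = s k.
Proof.
  intros Hc k.
  assert (Hpre : forall n i, (i <= n)%nat ->
            fuchs_solution c p q s u0 i = fuchs_prefix c p q s u0 n i).
  { induction n as [|n IH]; intros i Hi; [now replace i with 0%nat by lia|].
    simpl. destruct (le_dec i n) as [Hin|Hin]; [now apply IH|].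
    replace i with (S n) by lia. unfold fuchs_solution. simpl.
    destruct (le_dec (S n) n); [lia|reflexivity]. }
  unfold fuchs. rewrite (lower_order_ext p q _ p q (fuchs_prefix c p q s u0 k)) by auto.
  assert (E : fuchs_solution c p q s u0 (S k)
    = (s k - lower_order p q (fuchs_prefix c p q s u0 k) k) / (INR (S k) * (INR k + c))).
  { unfold fuchs_solution. cbn [fuchs_prefix]. destruct (le_dec (S k) k); [lia|reflexivity]. }
  rewrite E. field. split; [apply Hc|apply INR_S_neq_0].
Qed.

(** The factor [k + 1] is the same for both terms: [(k - j) + (j + 1) = k + 1]. *)
Lemma lower_order_bound (K r U : R) p q u k :
  0 < r < 1 -> 0 <= K ->
  (forall j, Cmod (p j) <= K) -> (forall j, Cmod (q j) <= K * INR (S j)) ->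
  (forall j, (j <= k)%nat -> Cmod (u j) * r ^ j <= U) ->
  Cmod (lower_order p q u k) * r ^ k <= INR (S k) * (K * (U / (1 - r))).
Proof.
  intros Hr HK Hp Hq Hu.
  assert (HU : 0 <= U).
  { eapply Rle_trans; [|apply (Hu 0%nat); lia].
    apply Rmult_le_pos; [apply Cmod_ge_0|apply pow_le; lra]. }
  assert (H1 : Cmod (lower_order p q u k)
               <= sum_n (fun j => K * INR (S k) * Cmod (u (k - j)%nat))%R k).
  { unfold lower_order, conv. rewrite <- (sum_n_plus (G := C_AbelianMonoid)).
    apply Cmod_sum_n. intros j Hj.
    change (Cmod (p j * theta u (k - j) + q j * u (k - j)%nat)
      <= K * INR (S k) * Cmod (u (k - j)%nat)).
    eapply Rle_trans; [apply Cmod_triangle|].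
    unfold theta. rewrite !Cmod_mult, Cmod_nonneg_real by apply pos_INR.
    replace (INR (S k)) with (INR (k - j) + INR (S j))%R
      by (rewrite <- plus_INR; f_equal; lia).
    pose proof (Cmod_ge_0 (u (k - j)%nat)) as Hm.
    pose proof (pos_INR (k - j)) as Hi.
    replace (K * (INR (k - j) + INR (S j)) * Cmod (u (k - j)%nat))%R
      with (K * (INR (k - j) * Cmod (u (k - j)%nat)) + K * INR (S j) * Cmod (u (k - j)%nat))%R
      by ring.
    apply Rplus_le_compat; apply Rmult_le_compat_r; auto.
    now apply Rmult_le_pos. }
  assert (Hgeom : sum_n (fun j => r ^ j)%R k <= / (1 - r)).
  { apply sum_n_le_series; [intros; apply pow_le; lra|].
    apply is_series_geom. rewrite Rabs_pos_eq; lra. }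
  apply Rle_trans with (r ^ k * sum_n (fun j => K * INR (S k) * Cmod (u (k - j)%nat))%R k)%R.
  { rewrite Rmult_comm. apply Rmult_le_compat_l; [apply pow_le; lra|assumption]. }
  rewrite <- (sum_n_mult_l (K := R_Ring) (r ^ k)%R).
  apply Rle_trans with (sum_n (fun j => (INR (S k) * (K * U)) * r ^ j)%R k).
  - apply sum_n_le_R. intros j Hj. change (mult ?a ?b) with (a * b)%R.
    replace (r ^ k)%R with (r ^ j * r ^ (k - j))%R by (rewrite <- pow_add; f_equal; lia).
    replace (r ^ j * r ^ (k - j) * (K * INR (S k) * Cmod (u (k - j)%nat)))%R
      with (INR (S k) * (K * (Cmod (u (k - j)%nat) * r ^ (k - j))) * r ^ j)%R by ring.
    apply Rmult_le_compat_r; [apply pow_le; lra|].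
    apply Rmult_le_compat_l; [apply pos_INR|].
    apply Rmult_le_compat_l; [assumption|]. apply Hu. lia.
  - rewrite (sum_n_mult_l (K := R_Ring) (INR (S k) * (K * U))%R).
    change (mult ?a ?b) with (a * b)%R.
    replace (INR (S k) * (K * (U / (1 - r))))%R with (INR (S k) * (K * U) * / (1 - r))%R
      by (field; lra).
    apply Rmult_le_compat_l; [|assumption].
    apply Rmult_le_pos; [apply pos_INR|now apply Rmult_le_pos].
Qed.

(** One step of the recurrence divides by [k + c], which eventually exceeds the
    bound of the other terms; only finitely many steps can increase the constant. *)
Lemma fuchs_bound c (K r : R) :
  (forall k, INR k + c <> 0) -> 0 < r < 1 -> 0 <= K ->
  exists M : R, 0 <= M /\ forall p q u (S0 : R),
    (forall j, Cmod (p j) <= K) -> (forall j, Cmod (q j) <= K * INR (S j)) -> 0 <= S0 ->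
    (forall k, Cmod (fuchs c p q u k) * r ^ k <= INR (S k) * S0) ->
    forall k, Cmod (u k) * r ^ k <= M * (Cmod (u 0%nat) + S0).
Proof.
  intros Hc Hr HK.
  assert (Hm : forall k, 0 < Cmod (INR k + c)) by (intros k; apply Cmod_gt_0, Hc).
  assert (Hstep : forall p q u (S0 U : R) k,
    (forall j, Cmod (p j) <= K) -> (forall j, Cmod (q j) <= K * INR (S j)) ->
    (forall k, Cmod (fuchs c p q u k) * r ^ k <= INR (S k) * S0) ->
    (forall j, (j <= k)%nat -> Cmod (u j) * r ^ j <= U) ->
    Cmod (u (S k)) * r ^ S k <= (S0 + K * (U / (1 - r))) / Cmod (INR k + c)).
  { intros p q u S0 U k Hp Hq Hs Hu. specialize (Hs k). specialize (Hm k).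
    assert (Hl := lower_order_bound K r U p q u k Hr HK Hp Hq Hu).
    assert (Hk : 0 < INR (S k)) by (apply lt_0_INR; lia).
    assert (Hrk : 0 < (r ^ k)%R) by (apply pow_lt; lra).
    apply (proj1 (Rle_div_r _ _ _ Hm)).
    assert (E : INR (S k) * (INR k + c) * u (S k)
                = fuchs c p q u k - lower_order p q u k) by (unfold fuchs; ring).
    assert (Hn : Cmod (INR (S k) * (INR k + c) * u (S k)) * r ^ k
                 <= INR (S k) * (S0 + K * (U / (1 - r)))).
    { rewrite E, Rmult_plus_distr_l.
      eapply Rle_trans; [apply Rmult_le_compat_r; [lra|apply Cmod_triangle_minus]|].
      rewrite Rmult_plus_distr_r. lra. }
    rewrite !Cmod_mult, (Cmod_nonneg_real (INR (S k))) in Hn by lra.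
    apply (Rmult_le_reg_l (INR (S k))); [assumption|].
    eapply Rle_trans; [|exact Hn]. rewrite <- tech_pow_Rmult.
    assert (Hu0 := Cmod_ge_0 (u (S k))).
    replace (INR (S k) * (Cmod (u (S k)) * (r * r ^ k) * Cmod (INR k + c)))%R
      with (r * (INR (S k) * Cmod (INR k + c) * Cmod (u (S k)) * r ^ k))%R by ring.
    set (X := (INR (S k) * Cmod (INR k + c) * Cmod (u (S k)) * r ^ k)%R).
    rewrite <- (Rmult_1_l X) at 2. apply Rmult_le_compat_r; [|lra]. unfold X.
    apply Rmult_le_pos; [|lra]. apply Rmult_le_pos; [|assumption].
    apply Rmult_le_pos; lra. }
  assert (Hfin : forall N, exists M : R, 1 <= M /\ forall p q u (S0 : R),
    (forall j, Cmod (p j) <= K) -> (forall j, Cmod (q j) <= K * INR (S j)) -> 0 <= S0 ->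
    (forall k, Cmod (fuchs c p q u k) * r ^ k <= INR (S k) * S0) ->
    forall k, (k <= N)%nat -> Cmod (u k) * r ^ k <= M * (Cmod (u 0%nat) + S0)).
  { induction N as [|N [M [HM1 HM]]].
    - exists 1%R. split; [lra|]. intros p q u S0 _ _ HS _ k Hk.
      replace k with 0%nat by lia. simpl. lra.
    - specialize (Hm N).
      assert (Hadd : 0 <= (1 + K * (M / (1 - r))) / Cmod (INR N + c)).
      { apply Rdiv_le_0_compat; [|assumption].
        assert (0 <= K * (M / (1 - r)))%R; [|lra].
        apply Rmult_le_pos; [assumption|]. apply Rdiv_le_0_compat; lra. }
      exists (M + (1 + K * (M / (1 - r))) / Cmod (INR N + c))%R. split; [lra|].
      intros p q u S0 Hp Hq HS Hs k Hk.
      pose proof (Cmod_ge_0 (u 0%nat)) as Hu0.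
      destruct (Nat.eq_dec k (S N)) as [->|Hne].
      + eapply Rle_trans.
        * apply (Hstep p q u S0 (M * (Cmod (u 0%nat) + S0))%R N Hp Hq Hs).
          intros j Hj. now apply (HM p q).
        * set (T := (Cmod (u 0%nat) + S0)%R).
          assert (HT : S0 <= T) by (unfold T; lra).
          assert (HMT : 0 <= M * T) by (apply Rmult_le_pos; unfold T; lra).
          replace ((M + (1 + K * (M / (1 - r))) / Cmod (INR N + c)) * T)%R
            with (M * T + (T + K * (M * T / (1 - r))) / Cmod (INR N + c))%R by (field; lra).
          assert ((S0 + K * (M * T / (1 - r))) / Cmod (INR N + c)
            <= (T + K * (M * T / (1 - r))) / Cmod (INR N + c)); [|lra].
          apply Rmult_le_compat_r; [apply Rlt_le, Rinv_0_lt_compat; assumption|lra].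
      + eapply Rle_trans; [apply (HM p q u S0 Hp Hq HS Hs k); lia|].
        apply Rmult_le_compat_r; lra. }
  (* Beyond [N] one step no longer increases the bound. *)
  destruct (INR_archimed 1 (Cmod c + 1 + K / (1 - r)) ltac:(lra)) as [N HN].
  rewrite Rmult_1_r in HN.
  destruct (Hfin N) as [M [HM1 HM]].
  exists M. split; [lra|]. intros p q u S0 Hp Hq HS Hs k.
  set (T := (Cmod (u 0%nat) + S0)%R).
  assert (HT : 0 <= S0 <= T) by (unfold T; pose proof (Cmod_ge_0 (u 0%nat)); lra).
  assert (Hall : forall n j, (j <= n)%nat -> Cmod (u j) * r ^ j <= M * T).
  { induction n as [|n IH]; intros j Hj; [apply (HM p q); auto; lia|].
    destruct (le_lt_dec j N) as [HjN|HjN]; [now apply (HM p q)|].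
    destruct (Nat.eq_dec j (S n)) as [->|Hne]; [|apply IH; lia].
    eapply Rle_trans; [apply (Hstep p q u S0 (M * T)%R n Hp Hq Hs IH)|].
    apply Rle_div_l; [apply Hm|].
    assert (Hbig : 1 + K / (1 - r) <= Cmod (INR n + c)).
    { assert (H1 : INR N <= INR n) by (apply le_INR; lia).
      pose proof (Cmod_triangle_rev (INR n) (- c)) as H2.
      rewrite Cmod_opp, Cmod_nonneg_real in H2 by apply pos_INR.
      replace (INR n - - c) with (INR n + c) in H2 by ring. lra. }
    assert (HMT : T <= M * T).
    { rewrite <- (Rmult_1_l T) at 1. apply Rmult_le_compat_r; lra. }
    apply Rle_trans with (M * T * (1 + K / (1 - r)))%R.
    - replace (M * T * (1 + K / (1 - r)))%R with (M * T + K * (M * T / (1 - r)))%R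
        by (field; lra). lra.
    - apply Rmult_le_compat_l; lra. }
  now apply (Hall k).
Qed.

(** * Elementary power series *)

Lemma ps_on_of_bounded u (M : R) : (forall k, Cmod (u k) <= M) -> exists f, ps_on 1 u f.
Proof.
  intros H. apply ps_on_of_bounds. intros s Hs. exists M. intros k.
  apply Rle_trans with (Cmod (u k) * 1)%R; [|rewrite Rmult_1_r; apply H].
  apply Rmult_le_compat_l; [apply Cmod_ge_0|].
  rewrite <- (pow1 k). apply pow_incr. lra.
Qed.

Lemma one_minus_neq_0 z : Cmod z < 1 -> 1 - z <> 0.
Proof.
  intros Hz E. assert (z = 1) by (replace z with (1 - (1 - z)) by ring; rewrite E; ring).
  subst z. rewrite Cmod_1 in Hz. lra.
Qed.

Lemma one_plus_neq_0 z : Cmod z < 1 -> 1 + z <> 0.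
Proof.
  intros Hz. replace (1 + z) with (1 - - z) by ring. apply one_minus_neq_0.
  now rewrite Cmod_opp.
Qed.

(** The sum [f] satisfies [f z = 1 + z * f z], since removing the first coefficient
    leaves the sequence unchanged. *)
Lemma ps_on_geom : ps_on 1 (fun _ => RtoC 1) (fun z => / (1 - z)).
Proof.
  destruct (ps_on_of_bounded (fun _ => RtoC 1) 1) as [f Hf].
  { intros _. rewrite Cmod_1. lra. }
  eapply ps_on_ext; [reflexivity| |exact Hf]. intros z Hz.
  destruct (ps_on_tail 1 _ f Hf) as [g [Hg Hfg]].
  assert (E : g z = f z)
    by exact (is_series_C_unique _ _ _ (ps_on_series 1 _ g z Hg Hz) (ps_on_series 1 _ f z Hf Hz)).
  specialize (Hfg z Hz). rewrite E in Hfg.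
  assert (Hn := one_minus_neq_0 z Hz).
  replace (f z) with ((f z - z * f z) / (1 - z)) by (field; assumption).
  rewrite Hfg at 1. field. assumption.
Qed.

Lemma ps_on_geom_alt : ps_on 1 (fun k => (- (1)) ^ k) (fun z => / (1 + z)).
Proof.
  apply ps_on_intro. intros z Hz.
  replace (/ (1 + z)) with (/ (1 - - z)) by (f_equal; ring).
  eapply is_series_ext; [|apply (ps_on_series 1 _ _ (- z) ps_on_geom); now rewrite Cmod_opp].
  intros k. simpl. replace (- z) with (- (1) * z) by ring. rewrite Cpow_mult_l. C_ring.
Qed.

Definition even_coef (k : nat) : C := / 2 * (1 + (- (1)) ^ k).

Lemma Cmod_alt_sign k : Cmod ((- (1)) ^ k) = 1%R.
Proof. rewrite Cmod_pow, Cmod_opp, Cmod_1. apply pow1. Qed.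

Lemma RtoC_2_neq_0 : RtoC 2 <> 0.
Proof. intros E. apply RtoC_inj in E. lra. Qed.

Lemma Cmod_even_coef k : Cmod (even_coef k) <= 1.
Proof.
  unfold even_coef. rewrite Cmod_mult, Cmod_inv, Cmod_nonneg_real by (apply RtoC_2_neq_0 || lra).
  pose proof (Cmod_triangle 1 ((- (1)) ^ k)) as H. rewrite Cmod_1, Cmod_alt_sign in H. lra.
Qed.

Lemma ps_on_even : ps_on 1 even_coef (fun z => / (1 - z * z)).
Proof.
  eapply ps_on_ext; [| |apply (ps_on_scal 1 (/ 2)), (ps_on_plus 1 _ _ _ _ ps_on_geom ps_on_geom_alt)].
  - reflexivity.
  - intros z Hz. simpl.
    assert (H1 := one_minus_neq_0 z Hz). assert (H2 := one_plus_neq_0 z Hz).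
    replace (1 - z * z) with ((1 - z) * (1 + z)) by ring.
    field. repeat split; assumption || apply RtoC_2_neq_0.
Qed.

Lemma ps_on_alt_square : ps_on 1 (fun k => (- (1)) ^ k * INR (S k)) (fun z => / ((1 + z) * (1 + z))).
Proof.
  destruct (ps_on_derive 1 _ _ ps_on_geom_alt) as [H Hd].
  eapply ps_on_ext; [| |apply (ps_on_scal 1 (- (1)) _ _ H)].
  - intros k. unfold deriv_coef. simpl. ring.
  - intros z Hz. simpl. assert (H2 := one_plus_neq_0 z Hz).
    assert (E : C_is_derive (fun z => / (1 + z)) z ((0 + 1) * - / ((1 + z) * (1 + z)))).
    { apply (is_derive_C_comp Cinv (fun z => 1 + z)).
      - now apply is_derive_C_inv.
      - apply is_derive_C_plus; [apply is_derive_C_const|apply is_derive_C_id]. }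
    rewrite (is_derive_C_unique _ _ _ _ (Hd z Hz) E). field. assumption.
Qed.

Lemma ps_on_theta r u f : ps_on r u f -> ps_on r (theta u) (fun z => z * C_derive f z).
Proof.
  intros H. destruct (ps_on_derive r u f H) as [Hd _].
  apply ps_on_intro. intros z Hz.
  apply (is_series_decr_1 (V := C_NormedModule)).
  change (C_series (fun k => theta u (S k) * z ^ S k)
    (z * C_derive f z + - (INR 0 * u 0%nat * z ^ 0))).
  replace (z * C_derive f z + - (INR 0 * u 0%nat * z ^ 0)) with (z * C_derive f z)
    by (simpl; ring).
  eapply is_series_ext; [|apply (is_series_C_scal z _ _ (ps_on_series r _ _ z Hd Hz))].
  intros k. unfold theta, deriv_coef.
  change (z * (INR (S k) * u (S k) * z ^ k) = INR (S k) * u (S k) * (z * z ^ k)). ring.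
Qed.

Lemma analytic_at_inv (z0 : C) : z0 <> 0 -> analytic_at Cinv z0.
Proof.
  intros Hz0.
  assert (Hg : analytic_at (fun z => / (1 - z)) 0).
  { apply (ps_on_analytic 1 _ _ 0 ps_on_geom). rewrite Cmod_0. lra. }
  assert (Hm : 0 < Cmod z0) by now apply Cmod_gt_0.
  apply (analytic_at_ext (fun z => / z0 * / (1 - / z0 * (z0 - z))) _ z0 (Cmod z0)); [assumption| |].
  - intros z Hz.
    destruct (excluded_middle_informative (z = 0)) as [->|Hne].
    + exfalso. replace (0 - z0) with (- z0) in Hz by ring. rewrite Cmod_opp in Hz. lra.
    + replace (1 - / z0 * (z0 - z)) with (z / z0) by (field; assumption).
      field. now split.
  - apply analytic_at_scal.
    apply (analytic_at_comp (fun t => / (1 - t)) (fun z => / z0 * (z0 - z))).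
    + replace (/ z0 * (z0 - z0)) with (RtoC 0) by ring. exact Hg.
    + apply analytic_at_scal.
      apply (analytic_at_ext (fun z => (- (1)) * ((- z0) + z)) _ z0 1); [lra|intros; ring|].
      apply analytic_at_scal, analytic_at_translation.
Qed.

(** * The square root on the plane cut along the negative half-line *)

(** Coefficients of [sqrt (1 - t)]. *)
Fixpoint sqrt_coef (k : nat) : C :=
  match k with
  | O => 1
  | S k' => sqrt_coef k' * RtoC ((INR k' - / 2) / INR (S k'))
  end.

(** The series [f] solves [(1 - t) f' = - f / 2], hence [f ^ 2] solves
    [(1 - t) h' = - h]; the recurrence this gives for the coefficients of [f ^ 2]
    stops after [1 - t]. *)
Lemma ps_on_sqrt : exists S, ps_on 1 sqrt_coef S /\ forall t, Cmod t < 1 -> S t * S t = 1 - t.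
Proof.
  destruct (ps_on_of_bounded sqrt_coef 1) as [f Hf].
  { induction k as [|k IH]; [simpl; rewrite Cmod_1; lra|].
    cbn [sqrt_coef]. rewrite Cmod_mult, Cmod_R.
    rewrite <- (Rmult_1_l 1). apply Rmult_le_compat; try apply Cmod_ge_0; try apply Rabs_pos; [assumption|].
    rewrite S_INR. pose proof (pos_INR k). apply Rabs_le. split.
    - apply (proj1 (Rle_div_r _ _ (INR k + 1) ltac:(lra))). lra.
    - apply (proj2 (Rle_div_l _ _ (INR k + 1) ltac:(lra))). lra. }
  exists f. split; [assumption|].
  set (a := conv sqrt_coef sqrt_coef).
  assert (Ha : ps_on 1 a (fun t => f t * f t)) by exact (ps_on_mult 1 _ _ _ _ Hf Hf).
  destruct (ps_on_derive 1 _ _ Hf) as [Hf' Hdf].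
  destruct (ps_on_derive 1 _ _ Ha) as [Ha' Hda].
  assert (Hode : forall t, Cmod t < 1 -> C_derive f t = t * C_derive f t + (- / 2) * f t).
  { intros t Ht.
    apply (is_series_C_unique _ _ _ (ps_on_series 1 _ _ t Hf' Ht)).
    eapply is_series_ext; [|apply (ps_on_series 1 _ _ t
      (ps_on_plus 1 _ _ _ _ (ps_on_theta 1 _ _ Hf) (ps_on_scal 1 (- / 2) _ _ Hf)) Ht)].
    intros k. unfold theta, deriv_coef. cbn [sqrt_coef].
    apply (f_equal (fun c => c * t ^ k)).
    assert (Hk : INR (S k) <> 0%R) by (apply not_0_INR; lia).
    rewrite RtoC_div, RtoC_minus, RtoC_inv by (assumption || lra).
    assert (Hk' := INR_S_neq_0 k). field. assumption. }
  assert (Hode2 : forall t, Cmod t < 1 ->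
    C_derive (fun t => f t * f t) t = t * C_derive (fun t => f t * f t) t + (- (1)) * (f t * f t)).
  { intros t Ht.
    assert (E : C_derive (fun t => f t * f t) t = C_derive f t * f t + f t * C_derive f t)
      by exact (is_C_derive_unique _ _ _ (is_derive_C_mult _ _ _ _ _ (Hdf t Ht) (Hdf t Ht))).
    rewrite E.
    rewrite (Hode t Ht) at 1 2. field. }
  assert (Hrec : forall k, INR (S k) * a (S k) = (INR k - 1) * a k).
  { intros k.
    assert (E := ps_on_unique 1 (deriv_coef a) (fun k => theta a k + (- (1)) * a k)
      (C_derive (fun t => f t * f t)) ltac:(lra) Ha').
    unfold deriv_coef, theta in E. rewrite E; [ring|].
    eapply ps_on_ext; [reflexivity| |exact
      (ps_on_plus 1 _ _ _ _ (ps_on_theta 1 _ _ Ha) (ps_on_scal 1 (- (1)) _ _ Ha))].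
    intros t Ht. simpl. now rewrite <- Hode2. }
  assert (Ha0 : a 0%nat = 1).
  { unfold a, conv. rewrite sum_O. simpl. ring. }
  assert (Ha1 : a 1%nat = - (1)).
  { specialize (Hrec 0%nat). rewrite Ha0 in Hrec. simpl in Hrec.
    replace (a 1%nat) with (1 * a 1%nat) by ring. rewrite Hrec. ring. }
  assert (Ha2 : forall k, a (S (S k)) = 0).
  { induction k as [|k IH].
    - specialize (Hrec 1%nat). assert (H0 := INR_S_neq_0 1).
      replace (a 2%nat) with (/ INR 2 * (INR 2 * a 2%nat)) by (field; assumption).
      rewrite Hrec. change (INR 1) with 1%R. ring.
    - specialize (Hrec (S (S k))). rewrite IH in Hrec.
      assert (H0 := INR_S_neq_0 (S (S k))).
      replace (a (S (S (S k)))) with (/ INR (S (S (S k))) * (INR (S (S (S k))) * a (S (S (S k)))))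
        by (field; assumption).
      rewrite Hrec. ring. }
  intros t Ht.
  apply (is_series_C_unique _ _ _ (ps_on_series 1 _ _ t Ha Ht)).
  pose (b := fun k => a k * t ^ k).
  assert (E : sum_n b 1 = 1 - t).
  { rewrite sum_Sn, sum_O. unfold b. rewrite Ha0, Ha1.
    change (1 * 1 + - (1) * (t * 1) = 1 - t). ring. }
  change (C_series b (1 - t)). rewrite <- E.
  apply (is_series_finite (V := C_NormedModule) b 1).
  intros [|[|k]] Hk; [lia|lia|]. unfold b. rewrite Ha2.
  change (0 * t ^ S (S k) = 0). ring.
Qed.

Definition csqrt (z : C) : C :=
  let p := sqrt ((Cmod z + Re z) / 2) in (p, (Im z / (2 * p))%R).

Lemma csqrt_spec z : 0 < Cmod z + Re z -> 0 < Re (csqrt z) /\ csqrt z * csqrt z = z.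
Proof.
  intros Hz. unfold csqrt. set (p := sqrt ((Cmod z + Re z) / 2)).
  assert (Hp : 0 < p) by (apply sqrt_lt_R0; lra).
  assert (Hp2 : (p * p = (Cmod z + Re z) / 2)%R) by (apply sqrt_sqrt; lra).
  split; [exact Hp|].
  assert (Hm := Cmod2_alt z).
  assert (Hq : (Im z / (2 * p) * (Im z / (2 * p)) = (Cmod z - Re z) / 2)%R).
  { replace (Im z / (2 * p) * (Im z / (2 * p)))%R with (Im z ^ 2 / (4 * (p * p)))%R by (field; lra).
    rewrite Hp2. replace (Im z ^ 2)%R with ((Cmod z - Re z) * (Cmod z + Re z))%R by lra.
    field. lra. }
  unfold Cmult. cbn [fst snd]. rewrite Hp2, Hq.
  rewrite (surjective_pairing z) at 7. f_equal; fold (Re z) (Im z).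
  - lra.
  - field. lra.
Qed.

Lemma csqrt_unique y z : 0 < Re y -> y * y = z -> csqrt z = y.
Proof.
  intros Hy E.
  assert (Hpos : 0 < Cmod z + Re z).
  { rewrite <- E, Cmod_mult.
    replace (Cmod y * Cmod y)%R with (Cmod y ^ 2)%R by ring.
    rewrite Cmod2_alt, re_mult. nra. }
  destruct (csqrt_spec z Hpos) as [Hs Hss]. set (s := csqrt z) in *.
  assert (Hsum : s + y <> 0).
  { intros H. apply (f_equal Re) in H. rewrite re_plus, re_RtoC in H. lra. }
  assert (Hz : (s - y) * (s + y) = 0).
  { replace ((s - y) * (s + y)) with (s * s - y * y) by ring. rewrite Hss, E. ring. }
  replace s with ((s - y) * (s + y) / (s + y) + y) by (field; assumption).
  rewrite Hz. unfold Cdiv. ring.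
Qed.

Lemma re_continuity y y' : Re y - Cmod (y' - y) <= Re y'.
Proof.
  pose proof (re_le_Cmod (y' - y)) as H.
  replace (y' - y) with (y' + - y) in H at 1 by ring.
  rewrite re_plus, re_opp in H. apply Rabs_le_between in H. lra.
Qed.

(** Near [z0] the root is [csqrt z0] times the binomial series in [(z0 - z) / z0]:
    the square is right, and the real part stays positive by continuity. *)
Lemma analytic_at_csqrt z0 : 0 < Cmod z0 + Re z0 -> analytic_at csqrt z0.
Proof.
  intros Hz0. destruct (csqrt_spec z0 Hz0) as [Hs Hss]. set (s := csqrt z0) in *.
  assert (Hne : z0 <> 0).
  { intros E. rewrite E, Cmod_0, re_RtoC in Hz0. lra. }
  destruct ps_on_sqrt as [f [Hf Hff]].
  pose (g := fun z => s * f (/ z0 * (z0 - z))).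
  assert (Hlin : analytic_at (fun z => / z0 * (z0 - z)) z0).
  { apply analytic_at_scal.
    apply (analytic_at_ext (fun z => (- (1)) * ((- z0) + z)) _ z0 1); [lra|intros; ring|].
    apply analytic_at_scal, analytic_at_translation. }
  assert (Hg : analytic_at g z0).
  { apply analytic_at_scal. apply (analytic_at_comp f); [|exact Hlin].
    replace (/ z0 * (z0 - z0)) with (RtoC 0) by ring.
    apply (ps_on_analytic 1 _ _ _ Hf). rewrite Cmod_0. lra. }
  assert (Hg0 : g z0 = s).
  { unfold g. replace (/ z0 * (z0 - z0)) with (RtoC 0) by ring.
    rewrite (ps_on_at_0 1 _ _ Rlt_0_1 Hf). simpl. ring. }
  destruct (analytic_at_continuous g z0 Hg (Re s) Hs) as [d1 [Hd1 H1]].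
  destruct (analytic_at_continuous _ z0 Hlin 1%R Rlt_0_1) as [d2 [Hd2 H2]].
  apply (analytic_at_ext g _ z0 (Rmin d1 d2)); [now apply Rmin_glb_lt| |assumption].
  intros z Hz. symmetry. apply csqrt_unique.
  - specialize (H1 z (Rlt_le_trans _ _ _ Hz (Rmin_l _ _))). rewrite Hg0 in H1.
    pose proof (re_continuity s (g z)). lra.
  - specialize (H2 z (Rlt_le_trans _ _ _ Hz (Rmin_r _ _))).
    replace (/ z0 * (z0 - z) - / z0 * (z0 - z0)) with (/ z0 * (z0 - z)) in H2 by ring.
    unfold g. replace (s * f (/ z0 * (z0 - z)) * (s * f (/ z0 * (z0 - z))))
      with ((s * s) * (f (/ z0 * (z0 - z)) * f (/ z0 * (z0 - z)))) by ring.
    rewrite Hss, Hff by assumption. field. assumption.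
Qed.

(** * Uniformisation of the cut plane by the unit disc *)

(** With [y = csqrt (1 - x)] in the right half-plane, the Cayley transform of [y]. *)
Definition disc_coord (x : C) : C := - (1) + 2 * / (1 + csqrt (1 - x)).

Lemma slit_plane_pos x : slit_plane x -> 0 < Cmod (1 - x) + Re (1 - x).
Proof.
  intros Hx. apply Rnot_le_lt. intros Hle. apply Hx.
  pose proof (re_le_Cmod (1 - x)) as H. apply Rabs_le_between in H.
  assert (Hm := Cmod2_alt (1 - x)).
  assert (E1 : Re (1 - x) = (1 - Re x)%R) by reflexivity.
  assert (E2 : Im (1 - x) = (0 - Im x)%R) by reflexivity.
  replace (Cmod (1 - x)) with (- Re (1 - x))%R in * by lra.
  rewrite E1, E2 in *. split; [|lra]. nra.
Qed.

Lemma disc_coord_spec x (y := csqrt (1 - x)) (w := disc_coord x) :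
  slit_plane x ->
  0 < Re y /\ y * y = 1 - x /\ Cmod w < 1 /\ y = (1 - w) / (1 + w) /\
  x = 4 * w * / ((1 + w) * (1 + w)).
Proof.
  intros Hx. destruct (csqrt_spec _ (slit_plane_pos x Hx)) as [Hy Hyy]. fold y in Hy, Hyy.
  assert (Hn : 1 + y <> 0).
  { intros E. apply (f_equal Re) in E. rewrite re_plus, !re_RtoC in E. lra. }
  assert (Hw : w = (1 - y) / (1 + y)).
  { unfold w, disc_coord. fold y. field. assumption. }
  assert (Hw1 : 1 + w = 2 / (1 + y)) by (rewrite Hw; field; assumption).
  assert (H2 := RtoC_2_neq_0).
  repeat split; try assumption.
  - rewrite Hw, Cmod_div by assumption.
    assert (Hp : 0 < Cmod (1 + y)) by now apply Cmod_gt_0.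
    apply Rlt_div_l; [assumption|]. rewrite Rmult_1_l.
    apply Rsqr_incrst_0; try apply Cmod_ge_0.
    rewrite !Rsqr_pow2, !Cmod2_alt.
    change (Re (1 - y)) with (1 - Re y)%R. change (Re (1 + y)) with (1 + Re y)%R.
    change (Im (1 - y)) with (0 - Im y)%R. change (Im (1 + y)) with (0 + Im y)%R. nra.
  - rewrite Hw1, Hw. field. assumption.
  - rewrite Hw1, Hw. replace x with (1 - y * y) at 1 by (rewrite Hyy; ring).
    field. assumption.
Qed.

Lemma analytic_at_disc_coord x : slit_plane x -> analytic_at disc_coord x.
Proof.
  intros Hx. destruct (disc_coord_spec x Hx) as [Hy _].
  assert (Hn : 1 + csqrt (1 - x) <> 0).
  { intros E. apply (f_equal Re) in E. rewrite re_plus, !re_RtoC in E. lra. }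
  apply (analytic_at_comp (fun t => - (1) + t) (fun x => 2 * / (1 + csqrt (1 - x))));
    [apply analytic_at_translation|].
  apply analytic_at_scal.
  apply (analytic_at_comp Cinv (fun x => 1 + csqrt (1 - x))); [now apply analytic_at_inv|].
  apply (analytic_at_comp (fun t => 1 + t) (fun x => csqrt (1 - x)));
    [apply analytic_at_translation|].
  apply (analytic_at_comp csqrt (fun x => 1 - x)); [now apply analytic_at_csqrt, slit_plane_pos|].
  apply (analytic_at_ext (fun z => (- (1)) * (- (1) + z)) _ x 1); [lra|intros; ring|].
  apply analytic_at_scal, analytic_at_translation.
Qed.

Lemma slit_plane_disc x : Cmod x < 1 -> slit_plane x.
Proof.
  intros Hx [_ H]. pose proof (re_le_Cmod x) as H1. apply Rabs_le_between in H1. lra.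
Qed.

Lemma slit_plane_ray x t : 0 <= t <= 1 -> slit_plane x -> slit_plane (RtoC t * x).
Proof.
  intros Ht Hx [H1 H2]. rewrite im_scal_l in H1. rewrite re_scal_l in H2. apply Hx.
  assert (Hx0 : 0 < Re x) by nra.
  apply Rmult_integral in H1. destruct H1 as [H1|H1]; [subst t; lra|].
  split; [assumption|nra].
Qed.

(** * The hypergeometric equation *)

Lemma ps_on_0 r : ps_on r (fun _ => RtoC 0) (fun _ => RtoC 0).
Proof. apply (ps_on_ext r _ _ _ _) with (3 := ps_on_const r 0); [|reflexivity]. now intros [|k]. Qed.

Lemma ps_on_fuchs r c p q u P Q f :
  ps_on r p P -> ps_on r q Q -> ps_on r u f ->
  ps_on r (fuchs c p q u)
    (fun z => z * C_derive (C_derive f) z + (c + z * P z) * C_derive f z + Q z * f z).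
Proof.
  intros Hp Hq Hu. destruct (ps_on_derive r u f Hu) as [Hu' _].
  eapply ps_on_ext; [| |apply (ps_on_plus r _ _ _ _
    (ps_on_plus r _ _ _ _ (ps_on_theta r _ _ Hu') (ps_on_scal r c _ _ Hu'))
    (ps_on_plus r _ _ _ _ (ps_on_mult r _ _ _ _ Hp (ps_on_theta r _ _ Hu))
       (ps_on_mult r _ _ _ _ Hq Hu)))].
  - intros k. unfold fuchs, lower_order. cbv beta.
    change (theta (deriv_coef u) k) with (INR k * (INR (S k) * u (S k))).
    change (deriv_coef u k) with (INR (S k) * u (S k)). ring.
  - intros z Hz. simpl. ring.
Qed.

(** For constant coefficient sequences the convolutions are partial sums. *)
Lemma lower_order_const p q u k :
  lower_order (fun _ => p) (fun _ => q) u (S k) =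
  lower_order (fun _ => p) (fun _ => q) u k + (p * INR (S k) + q) * u (S k).
Proof.
  assert (Hc : forall a v, conv (fun _ => a) v (S k) = conv (fun _ => a) v k + a * v (S k)).
  { intros a v. unfold conv.
    assert (E : forall m, sum_n (fun i => a * v (m - i)%nat) m = sum_n (fun i => a * v i) m).
    { assert (Hrev : forall (w : nat -> C) m, sum_n (fun i => w (m - i)%nat) m = sum_n w m).
      { intros w m. revert w. induction m as [|m IH]; intros w; [now rewrite !sum_O|].
        rewrite sum_Sn. rewrite (sum_Sn w).
        rewrite (sum_n_ext_loc _ (fun i => (fun j => w (S j)) (m - i)%nat)) by
          (intros i Hi; f_equal; lia).
        rewrite (IH (fun j => w (S j))). rewrite Nat.sub_diag.
        clear. induction m as [|m IH].
        - rewrite !sum_O. C_ring.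
        - rewrite (sum_Sn (fun j => w (S j))), (sum_Sn w).
          transitivity (plus (plus (sum_n (fun j => w (S j)) m) (w 0%nat)) (w (S (S m)))).
          + C_ring.
          + rewrite IH. reflexivity. }
      intros m. apply (Hrev (fun i => a * v i)). }
    rewrite !E. rewrite sum_Sn. reflexivity. }
  unfold lower_order. rewrite !Hc. unfold theta. ring.
Qed.

Lemma pochhammer_neq_0 c k : (forall k, INR k + c <> 0) -> pochhammer c k <> 0.
Proof.
  intros Hc.
  induction k as [|k IH]; simpl; [exact C1_nz|].
  apply Cmult_neq_0; [assumption|]. rewrite Cplus_comm. apply Hc.
Qed.

Lemma hyp2F1_coef_rec a b c k :
  (forall k, INR k + c <> 0) -> 
  INR (S k) * (INR k + c) * hyp2F1_coef a b c (S k)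
  = (INR k + a) * (INR k + b) * hyp2F1_coef a b c k.
Proof.
  intros Hc. unfold hyp2F1_coef. cbn [pochhammer].
  assert (H1 := pochhammer_neq_0 c k Hc). assert (H2 := INR_S_neq_0 k).
  assert (H3 : RtoC (INR (fact k)) <> 0).
  { intros E. apply RtoC_inj in E. revert E. apply INR_fact_neq_0. }
  assert (H4 : c + INR k <> 0) by (rewrite Cplus_comm; apply Hc).
  change (fact (S k)) with (S k * fact k)%nat. rewrite mult_INR, RtoC_mult.
  field. repeat split; try assumption.
Qed.

(** Divided by [1 - z], the hypergeometric equation has the form treated above, with
    constant coefficient sequences, whose partial sums telescope by the recurrence
    between consecutive coefficients. *)
Lemma hyp2F1_coef_fuchs a b c k :
  (forall k, INR k + c <> 0) -> 
  fuchs c (fun _ => c - a - b - 1) (fun _ => - (a * b)) (hyp2F1_coef a b c) k = 0.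
Proof.
  intros Hc. assert (H0 := fun k => hyp2F1_coef_rec a b c k Hc).
  set (t := hyp2F1_coef a b c) in *.
  induction k as [|k IH].
  - unfold fuchs. rewrite H0. unfold lower_order, conv, theta. rewrite !sum_O. simpl. ring.
  - unfold fuchs in *. rewrite H0, lower_order_const.
    set (w := lower_order (fun _ => c - a - b - 1) (fun _ => - (a * b)) t k) in *.
    replace w with (- (INR (S k) * (INR k + c) * t (S k)))
      by (replace w with (INR (S k) * (INR k + c) * t (S k) + w
                          - INR (S k) * (INR k + c) * t (S k)) by ring; rewrite IH; ring).
    rewrite S_INR, RtoC_plus. ring.
Qed.

Lemma fuchs_ps_on c p q u (K : R) :
  (forall k, INR k + c <> 0) -> 0 <= K -> (forall j, Cmod (p j) <= K) -> (forall j, Cmod (q j) <= K * INR (S j)) ->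
  (forall k, fuchs c p q u k = 0) -> exists f, ps_on 1 u f.
Proof.
  intros Hc HK Hp Hq Hu. apply ps_on_of_bounds. intros s Hs.
  set (r := ((1 + s) / 2)%R). assert (Hr : 0 < r < 1) by (unfold r; lra).
  destruct (fuchs_bound c K r Hc Hr HK) as [M [_ HM]].
  specialize (HM p q u 0%R Hp Hq (Rle_refl 0)).
  exists (M * (Cmod (u 0%nat) + 0))%R. intros k.
  eapply Rle_trans; [|apply HM].
  - apply Rmult_le_compat_l; [apply Cmod_ge_0|]. apply pow_incr. unfold r. lra.
  - intros n. rewrite Hu, Cmod_0. lra.
Qed.

Lemma hyp2F1_series_converges a b c :
  (forall k, INR k + c <> 0) -> exists f, ps_on 1 (hyp2F1_coef a b c) f.
Proof.
  intros Hc. set (K := (Cmod (c - a - b - 1) + Cmod (- (a * b)))%R).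
  pose proof (Cmod_ge_0 (c - a - b - 1)). pose proof (Cmod_ge_0 (- (a * b))).
  apply (fuchs_ps_on c (fun _ => c - a - b - 1) (fun _ => - (a * b)) _ K Hc).
  - unfold K. lra.
  - intros _. unfold K. lra.
  - intros j. apply Rle_trans with (K * 1)%R; [unfold K; lra|].
    apply Rmult_le_compat_l; [unfold K; lra|].
    rewrite S_INR. pose proof (pos_INR j). lra.
  - intros k. now apply hyp2F1_coef_fuchs.
Qed.

Lemma hyp2F1_coef_0 a b c : hyp2F1_coef a b c 0 = 1.
Proof. unfold hyp2F1_coef. simpl. field. Qed.

(** * The hypergeometric equation in the disc coordinate *)

Definition disc_p (a b c : C) (k : nat) : C := 2 * (c - 1) + (2 - 4 * (a + b)) * even_coef k.
Definition disc_q (a b : C) (k : nat) : C := - (4 * (a * b)) * ((- (1)) ^ k * INR (S k)).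

Definition disc_P (a b c : C) (z : C) : C := 2 * (c - 1) / (1 - z) + (2 - 4 * (a + b)) / (1 - z * z).
Definition disc_Q (a b : C) (z : C) : C := - (4 * (a * b)) / ((1 + z) * (1 + z)).

(** The numbers d_k of the expansion in the disc coordinate, normalised by d_0 = 1. *)
Definition disc_coef (a b c : C) : nat -> C :=
  fuchs_solution c (disc_p a b c) (disc_q a b) (fun _ => RtoC 0) 1.

Lemma ps_on_disc_p a b c : ps_on 1 (disc_p a b c) (disc_P a b c).
Proof.
  eapply ps_on_ext; [| |apply (ps_on_plus 1 _ _ _ _ (ps_on_scal 1 (2 * (c - 1)) _ _ ps_on_geom)
    (ps_on_scal 1 (2 - 4 * (a + b)) _ _ ps_on_even))].
  - intros k. unfold disc_p. simpl. ring.
  - intros z Hz. reflexivity.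
Qed.

Lemma ps_on_disc_q a b : ps_on 1 (disc_q a b) (disc_Q a b).
Proof.
  eapply ps_on_ext; [| |apply (ps_on_scal 1 (- (4 * (a * b))) _ _ ps_on_alt_square)];
  reflexivity.
Qed.

Definition disc_bound (a b c : C) : R :=
  (Cmod (2 * (c - 1)) + Cmod (2 - 4 * (a + b)) + Cmod (- (4 * (a * b))))%R.

Lemma disc_bound_pos a b c : 0 <= disc_bound a b c.
Proof.
  unfold disc_bound. pose proof (Cmod_ge_0 (2 * (c - 1))).
  pose proof (Cmod_ge_0 (2 - 4 * (a + b))). pose proof (Cmod_ge_0 (- (4 * (a * b)))). lra.
Qed.

Lemma disc_p_bound a b c j : Cmod (disc_p a b c j) <= disc_bound a b c.
Proof.
  unfold disc_p, disc_bound. eapply Rle_trans; [apply Cmod_triangle|].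
  rewrite (Cmod_mult (2 - 4 * (a + b))).
  pose proof (Cmod_even_coef j). pose proof (Cmod_ge_0 (- (4 * (a * b)))).
  pose proof (Cmod_ge_0 (2 - 4 * (a + b))). nra.
Qed.

Lemma disc_q_bound a b c j : Cmod (disc_q a b j) <= disc_bound a b c * INR (S j).
Proof.
  unfold disc_q, disc_bound.
  rewrite Cmod_mult, (Cmod_mult (_ ^ j)), Cmod_alt_sign, Cmod_nonneg_real, Rmult_1_l
    by apply pos_INR.
  apply Rmult_le_compat_r; [apply pos_INR|].
  pose proof (Cmod_ge_0 (2 * (c - 1))). pose proof (Cmod_ge_0 (2 - 4 * (a + b))). lra.
Qed.

Lemma disc_coef_fuchs a b c k :
  (forall k, INR k + c <> 0) -> fuchs c (disc_p a b c) (disc_q a b) (disc_coef a b c) k = 0.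
Proof. intros Hc. exact (fuchs_solution_spec c _ _ (fun _ => RtoC 0) 1 Hc k). Qed.

Lemma disc_series_converges a b c :
  (forall k, INR k + c <> 0) -> exists f, ps_on 1 (disc_coef a b c) f.
Proof.
  intros Hc. apply (fuchs_ps_on c (disc_p a b c) (disc_q a b) _ (disc_bound a b c) Hc).
  - apply disc_bound_pos.
  - apply disc_p_bound.
  - apply disc_q_bound.
  - intros k. now apply disc_coef_fuchs.
Qed.

(** The inverse of [disc_coord]. *)
Definition koebe (z : C) : C := 4 * z * / ((1 + z) * (1 + z)).

Lemma is_derive_C_val f (z l l' : C) : l = l' -> C_is_derive f z l -> C_is_derive f z l'.
Proof. now intros ->. Qed.

Lemma is_derive_one_plus (z : C) : C_is_derive (fun z => 1 + z) z (0 + 1).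
Proof.
  exact (is_derive_C_plus (fun _ => RtoC 1) (fun z => z) z _ _
    (is_derive_C_const 1 z) (is_derive_C_id z)).
Qed.

Lemma is_derive_koebe z : 1 + z <> 0 ->
  C_is_derive koebe z (4 * (1 - z) * / ((1 + z) * ((1 + z) * (1 + z)))).
Proof.
  intros Hz. assert (H1 := is_derive_one_plus z).
  assert (H2 := is_derive_C_comp Cinv (fun z => (1 + z) * (1 + z)) z _ _
    (is_derive_C_inv _ (Cmult_neq_0 _ _ Hz Hz)) (is_derive_C_mult _ _ z _ _ H1 H1)).
  assert (H3 := is_derive_C_mult _ _ z _ _
    (is_derive_C_mult _ _ z _ _ (is_derive_C_const 4 z) (is_derive_C_id z)) H2).
  refine (is_derive_C_val _ _ _ _ _ H3). simpl. field. assumption.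
Qed.

Lemma is_derive_koebe' z : 1 + z <> 0 ->
  C_is_derive (fun z => 4 * (1 - z) * / ((1 + z) * ((1 + z) * (1 + z)))) z
    ((8 * z - 16) * / ((1 + z) * (1 + z) * ((1 + z) * (1 + z)))).
Proof.
  intros Hz. assert (H1 := is_derive_one_plus z).
  assert (H2 : C_is_derive (fun z => 1 - z) z (0 - 1)).
  { exact (is_derive_minus (V := C_NormedModule) _ _ _ _ _
      (is_derive_C_const 1 z) (is_derive_C_id z)). }
  assert (H3 := is_derive_C_mult (fun z => 1 + z) _ z _ _ H1 (is_derive_C_mult _ _ z _ _ H1 H1)).
  assert (H4 := is_derive_C_comp Cinv (fun z => (1 + z) * ((1 + z) * (1 + z))) z _ _
    (is_derive_C_inv _ (Cmult_neq_0 _ _ Hz (Cmult_neq_0 _ _ Hz Hz))) H3).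
  assert (H5 := is_derive_C_mult _ _ z _ _
    (is_derive_C_mult _ _ z _ _ (is_derive_C_const 4 z) H2) H4).
  refine (is_derive_C_val _ _ _ _ _ H5). simpl. field. assumption.
Qed.

Lemma analytic_at_koebe_0 : analytic_at koebe 0.
Proof.
  apply (ps_on_analytic 1 (fun k => 4 * conv (translation_coef 0)
    (fun k => (- (1)) ^ k * INR (S k)) k)); [|rewrite Cmod_0; lra].
  eapply ps_on_ext; [reflexivity| |apply (ps_on_scal 1 4), (ps_on_mult 1 _ _ _ _
    (ps_on_translation 1 0) ps_on_alt_square)].
  intros z _. unfold koebe. simpl. ring.
Qed.

Lemma hyp2F1_ode a b c F x :
  (forall k, INR k + c <> 0) -> ps_on 1 (hyp2F1_coef a b c) F -> Cmod x < 1 ->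
  x * C_derive (C_derive F) x + (c + x * ((c - a - b - 1) * / (1 - x))) * C_derive F x
  + - (a * b) * / (1 - x) * F x = 0.
Proof.
  intros Hc HF Hx.
  assert (Hconst : forall p, ps_on 1 (fun _ => p) (fun z => p * / (1 - z))).
  { intros p. eapply ps_on_ext; [|reflexivity|apply (ps_on_scal 1 p _ _ ps_on_geom)].
    intros k. simpl. ring. }
  assert (H := ps_on_fuchs 1 c _ _ _ _ _ F (Hconst (c - a - b - 1)) (Hconst (- (a * b))) HF).
  apply (is_series_C_unique _ _ _ (ps_on_series 1 _ _ x H Hx)).
  eapply is_series_ext; [|exact (ps_on_series 1 _ _ x (ps_on_0 1) Hx)].
  intros k. simpl. now rewrite hyp2F1_coef_fuchs.
Qed.

(** The substitution [x = koebe w] turns the hypergeometric equation into the one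
    defining [disc_coef], whose solution with value 1 at 0 is unique. *)
Lemma hyp2F1_koebe a b c F Phi :
  (forall k, INR k + c <> 0) ->
  ps_on 1 (hyp2F1_coef a b c) F -> ps_on 1 (disc_coef a b c) Phi ->
  exists d, 0 < d /\ forall w, Cmod w < d -> F (koebe w) = Phi w.
Proof.
  intros Hc HF HPhi.
  assert (Hk0 : koebe 0 = 0) by (unfold koebe; ring).
  assert (Hg : analytic_at (fun w => F (koebe w)) 0).
  { apply (analytic_at_comp F koebe 0); [|apply analytic_at_koebe_0].
    rewrite Hk0. apply (ps_on_analytic 1 _ _ _ HF). rewrite Cmod_0. lra. }
  apply analytic_at_ps in Hg. destruct Hg as [e [d0 [Hd0 He0]]].
  destruct (analytic_at_continuous koebe 0 analytic_at_koebe_0 1%R Rlt_0_1) as [d1 [Hd1 H1]].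
  set (d := Rmin (Rmin d0 d1) 1).
  assert (Hd : 0 < d) by (repeat apply Rmin_glb_lt; lra).
  assert (Hdd0 : d <= d0) by (eapply Rle_trans; apply Rmin_l).
  assert (Hdd1 : d <= d1) by (eapply Rle_trans; [apply Rmin_l|apply Rmin_r]).
  assert (Hd1' : d <= 1) by apply Rmin_r.
  set (g := fun w => F (koebe w)).
  assert (He : ps_on d e g).
  { apply (ps_on_mono d0); [assumption|].
    eapply ps_on_ext; [reflexivity| |exact He0].
    intros w _. simpl. now rewrite Cplus_0_l. }
  assert (Hkoebe : forall w, Cmod w < d -> Cmod (koebe w) < 1).
  { intros w Hw. specialize (H1 w). rewrite Hk0 in H1.
    replace (koebe w - 0) with (koebe w) in H1 by ring. apply H1.
    replace (w - 0) with w by ring. lra. }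
  destruct (ps_on_derive 1 _ _ HF) as [HF1 HdF].
  destruct (ps_on_derive 1 _ _ HF1) as [_ HdF1].
  set (X1 := fun w : C => 4 * (1 - w) * / ((1 + w) * ((1 + w) * (1 + w)))).
  set (X2 := fun w : C => (8 * w - 16) * / ((1 + w) * (1 + w) * ((1 + w) * (1 + w)))).
  assert (Hg1 : forall w, Cmod w < d -> C_derive g w = X1 w * C_derive F (koebe w)).
  { intros w Hw. apply is_C_derive_unique. apply (is_derive_C_comp F koebe).
    - now apply HdF, Hkoebe.
    - apply is_derive_koebe, one_plus_neq_0. lra. }
  assert (Hg2 : forall w, Cmod w < d -> C_derive (C_derive g) w =
     X2 w * C_derive F (koebe w) + X1 w * (X1 w * C_derive (C_derive F) (koebe w))).
  { intros w Hw. assert (Hw1 : 1 + w <> 0) by (apply one_plus_neq_0; lra).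
    apply is_C_derive_unique.
    apply (is_derive_C_ext_near (fun w => X1 w * C_derive F (koebe w)) _ w _ (d - Cmod w)); [lra| |].
    - intros y Hy. symmetry. apply Hg1.
      replace y with ((y - w) + w) by ring.
      eapply Rle_lt_trans; [apply Cmod_triangle|]. lra.
    - apply (is_derive_C_mult X1 (fun w => C_derive F (koebe w))); [now apply is_derive_koebe'|].
      apply (is_derive_C_comp (C_derive F) koebe).
      + now apply HdF1, Hkoebe.
      + now apply is_derive_koebe. }
  assert (Hode : forall w, Cmod w < d ->
    w * C_derive (C_derive g) w + (c + w * disc_P a b c w) * C_derive g w + disc_Q a b w * g w = 0).
  { intros w Hw.
    assert (Hwp : 1 + w <> 0) by (apply one_plus_neq_0; lra).
    assert (Hwm : 1 - w <> 0) by (apply one_minus_neq_0; lra).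
    rewrite Hg1, Hg2 by assumption. unfold g.
    assert (E := hyp2F1_ode a b c F (koebe w) Hc HF (Hkoebe w Hw)).
    replace (1 - koebe w) with ((1 - w) * (1 - w) * / ((1 + w) * (1 + w))) in E
      by (unfold koebe; field; assumption).
    (* The factor compares the coefficients [w * X1 w ^ 2] and [koebe w] of the
       second derivative of [F]. *)
    set (F0 := F (koebe w)) in *. set (F1 := C_derive F (koebe w)) in *.
    set (F2 := C_derive (C_derive F) (koebe w)) in *.
    transitivity (4 * (1 - w) * (1 - w) / ((1 + w) * (1 + w) * ((1 + w) * (1 + w))) * RtoC 0);
      [rewrite <- E|ring].
    unfold X1, X2, disc_P, disc_Q, koebe.
    replace (1 - w * w) with ((1 - w) * (1 + w)) by ring.
    field. now split. }
  assert (Hed : forall k, e k = disc_coef a b c k).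
  { apply (fuchs_unique c (disc_p a b c) (disc_q a b)); [assumption| |].
    - rewrite <- (ps_on_at_0 d e g Hd He). unfold g. rewrite Hk0.
      rewrite (ps_on_at_0 1 _ _ Rlt_0_1 HF). apply hyp2F1_coef_0.
    - intros k. rewrite disc_coef_fuchs by assumption.
      apply (ps_on_unique d _ (fun _ => RtoC 0) (fun _ => RtoC 0) Hd); [|apply ps_on_0].
      eapply ps_on_ext; [reflexivity| |exact (ps_on_fuchs d c _ _ _ _ _ g
        (ps_on_mono 1 d _ _ Hd1' (ps_on_disc_p a b c))
        (ps_on_mono 1 d _ _ Hd1' (ps_on_disc_q a b)) He)].
      exact Hode. }
  exists d. split; [assumption|]. intros w Hw.
  apply (is_series_C_unique _ _ _ (ps_on_series d _ g w He Hw)).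
  eapply is_series_ext; [|exact (ps_on_series 1 _ Phi w HPhi ltac:(lra))].
  intros k. simpl. now rewrite Hed.
Qed.

(** * The hypergeometric function on the cut plane *)

Lemma disc_coord_0 : disc_coord 0 = 0.
Proof.
  unfold disc_coord. rewrite (csqrt_unique 1 (1 - 0)).
  - field.
  - rewrite re_RtoC. lra.
  - ring.
Qed.

(** [hyp2F1_koebe] gives equality near 0 only; the whole disc [Cmod x < 1] is then
    reached by the identity theorem, both sides being analytic there. *)
Lemma is_hyp2F1_disc a b c Phi :
  (forall k, INR k + c <> 0) -> ps_on 1 (disc_coef a b c) Phi ->
  is_hyp2F1 a b c (fun x => Phi (disc_coord x)).
Proof.
  intros Hc HPhi.
  assert (Han : forall x, slit_plane x -> analytic_at (fun x => Phi (disc_coord x)) x).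
  { intros x Hx. apply (analytic_at_comp Phi disc_coord); [|now apply analytic_at_disc_coord].
    apply (ps_on_analytic 1 _ _ _ HPhi). now apply disc_coord_spec. }
  split; [|exact Han].
  destruct (hyp2F1_series_converges a b c Hc) as [F HF].
  assert (HE : forall x, Cmod x < 1 -> F x = Phi (disc_coord x)).
  { intros x Hx. apply (identity_theorem F (fun x => Phi (disc_coord x))).
    - intros t Ht. apply (ps_on_analytic 1 _ _ _ HF).
      rewrite Cmod_mult, Cmod_nonneg_real by lra. pose proof (Cmod_ge_0 x). nra.
    - intros t Ht. apply Han, slit_plane_ray; [assumption|]. now apply slit_plane_disc.
    - destruct (hyp2F1_koebe a b c F Phi Hc HF HPhi) as [d [Hd H]].
      assert (H0 : slit_plane 0) by (apply slit_plane_disc; rewrite Cmod_0; lra).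
      destruct (analytic_at_continuous _ 0 (analytic_at_disc_coord 0 H0) d Hd) as [d' [Hd' Hcont]].
      exists (Rmin d' 1). split; [apply Rmin_glb_lt; lra|]. intros z Hz.
      assert (Hz1 := Rlt_le_trans _ _ _ Hz (Rmin_l _ _)).
      assert (Hz2 := Rlt_le_trans _ _ _ Hz (Rmin_r _ _)).
      specialize (Hcont z). rewrite disc_coord_0 in Hcont.
      replace (z - 0) with z in Hcont by ring.
      replace (disc_coord z - 0) with (disc_coord z) in Hcont by ring.
      rewrite <- H by now apply Hcont.
      f_equal. apply (disc_coord_spec z). now apply slit_plane_disc. }
  intros x Hx. rewrite <- HE by assumption. now apply HF.
Qed.

Lemma is_hyp2F1_unique a b c F G x :
  is_hyp2F1 a b c F -> is_hyp2F1 a b c G -> slit_plane x -> F x = G x.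
Proof.
  intros [HF1 HF2] [HG1 HG2] Hx. apply identity_theorem.
  - intros t Ht. now apply HF2, slit_plane_ray.
  - intros t Ht. now apply HG2, slit_plane_ray.
  - exists 1%R. split; [lra|]. intros z Hz.
    exact (is_series_C_unique _ _ _ (HF1 z Hz) (HG1 z Hz)).
Qed.

Lemma hyp2F1_disc a b c Phi x :
  (forall k, INR k + c <> 0) -> ps_on 1 (disc_coef a b c) Phi -> slit_plane x ->
  hyp2F1 a b c x = Phi (disc_coord x).
Proof.
  intros Hc HPhi Hx. assert (H := is_hyp2F1_disc a b c Phi Hc HPhi).
  apply (is_hyp2F1_unique a b c _ (fun x => Phi (disc_coord x))); [|assumption|assumption].
  unfold hyp2F1. apply epsilon_spec. eexists. exact H.
Qed.

(** * Dependence on the parameters *)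

(** First- and second-order coefficients of [disc_p (a + eta) (b + eta) c] and
    [disc_q (a + eta) (b + eta)] in [eta]. *)
Definition disc_p1 (k : nat) : C := - (8) * even_coef k.
Definition disc_q1 (a b : C) (k : nat) : C := - (4 * (a + b)) * ((- (1)) ^ k * INR (S k)).
Definition disc_q2 (k : nat) : C := - (4) * ((- (1)) ^ k * INR (S k)).

(** The derivative in [eta] of [disc_coef (a + eta) (b + eta) c], from the
    differentiated recurrence. *)
Definition disc_coef_deriv (a b c : C) : nat -> C :=
  fuchs_solution c (disc_p a b c) (disc_q a b)
    (fun k => - lower_order disc_p1 (disc_q1 a b) (disc_coef a b c) k) 0.

Lemma disc_p_shift a b c eta k :
  disc_p (a + eta) (b + eta) c k = disc_p a b c k + eta * disc_p1 k.
Proof. unfold disc_p, disc_p1. ring. Qed.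

Lemma disc_q_shift a b eta k :
  disc_q (a + eta) (b + eta) k = disc_q a b k + eta * (disc_q1 a b k + eta * disc_q2 k).
Proof. unfold disc_q, disc_q1, disc_q2. ring. Qed.

Lemma Cmod_scal_even_coef (x : C) k : Cmod (x * even_coef k) <= Cmod x.
Proof.
  rewrite Cmod_mult. rewrite <- (Rmult_1_r (Cmod x)) at 2.
  apply Rmult_le_compat_l; [apply Cmod_ge_0|apply Cmod_even_coef].
Qed.

Lemma Cmod_scal_alt (x : C) k :
  Cmod (x * ((- (1)) ^ k * INR (S k))) = (Cmod x * INR (S k))%R.
Proof.
  rewrite !Cmod_mult, Cmod_alt_sign, Cmod_nonneg_real by apply pos_INR. ring.
Qed.

Lemma disc_uniform_bound a b c :
  exists K : R, 0 <= K /\ forall eta, Cmod eta <= 1 ->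
    (forall j, Cmod (disc_p (a + eta) (b + eta) c j) <= K) /\
    (forall j, Cmod (disc_q (a + eta) (b + eta) j) <= K * INR (S j)) /\
    (forall j, Cmod (disc_p1 j) <= K) /\
    (forall j, Cmod (disc_q1 a b j) <= K * INR (S j)) /\
    (forall j, Cmod (disc_q1 a b j + eta * disc_q2 j) <= K * INR (S j)) /\
    (forall j, Cmod (disc_q2 j) <= K * INR (S j)).
Proof.
  set (A := (Cmod (- (8)) + Cmod (- (4 * (a + b))) + Cmod (- (4)))%R).
  set (B := disc_bound a b c).
  assert (H8 := Cmod_ge_0 (- (8))). assert (Hab := Cmod_ge_0 (- (4 * (a + b)))).
  assert (H4 := Cmod_ge_0 (- (4))). assert (HB := disc_bound_pos a b c). fold B in HB.
  exists (B + A)%R. split; [unfold A; lra|]. intros eta Heta.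
  assert (He := Cmod_ge_0 eta).
  assert (Hp1 : forall j, Cmod (disc_p1 j) <= A).
  { intros j. eapply Rle_trans; [apply Cmod_scal_even_coef|]. unfold A. lra. }
  assert (Hq2 : forall j, Cmod (disc_q2 j) = (Cmod (- (4)) * INR (S j))%R)
    by (intros j; apply Cmod_scal_alt).
  assert (Hq1 : forall j, Cmod (disc_q1 a b j) = (Cmod (- (4 * (a + b))) * INR (S j))%R)
    by (intros j; apply Cmod_scal_alt).
  assert (Hq12 : forall j, Cmod (disc_q1 a b j + eta * disc_q2 j) <= A * INR (S j)).
  { intros j. eapply Rle_trans; [apply Cmod_triangle|].
    rewrite Cmod_mult, Hq1, Hq2. pose proof (pos_INR (S j)).
    assert (Cmod eta * (Cmod (- (4)) * INR (S j)) <= 1 * (Cmod (- (4)) * INR (S j))).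
    { apply Rmult_le_compat_r; [|assumption]. now apply Rmult_le_pos. }
    unfold A. nra. }
  repeat split; intros j; pose proof (pos_INR (S j)) as Hj.
  - rewrite disc_p_shift. eapply Rle_trans; [apply Cmod_triangle|].
    apply Rplus_le_compat; [apply disc_p_bound|].
    rewrite Cmod_mult. rewrite <- (Rmult_1_l A).
    apply Rmult_le_compat; auto using Cmod_ge_0.
  - rewrite disc_q_shift. eapply Rle_trans; [apply Cmod_triangle|].
    rewrite Rmult_plus_distr_r. apply Rplus_le_compat; [apply disc_q_bound|].
    rewrite Cmod_mult. rewrite <- (Rmult_1_l (A * INR (S j))).
    apply Rmult_le_compat; auto using Cmod_ge_0.
  - specialize (Hp1 j). lra.
  - rewrite Hq1. apply Rmult_le_compat_r; [assumption|]. unfold A. lra.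
  - eapply Rle_trans; [apply Hq12|]. apply Rmult_le_compat_r; [assumption|lra].
  - rewrite Hq2. apply Rmult_le_compat_r; [assumption|]. unfold A. lra.
Qed.

Lemma fuchs_shift a b c eta u k :
  fuchs c (disc_p (a + eta) (b + eta) c) (disc_q (a + eta) (b + eta)) u k =
  fuchs c (disc_p a b c) (disc_q a b) u k
  + eta * lower_order disc_p1 (fun n => disc_q1 a b n + eta * disc_q2 n) u k.
Proof.
  unfold fuchs.
  rewrite (lower_order_ext _ _ u (fun n => disc_p a b c n + eta * disc_p1 n)
    (fun n => disc_q a b n + eta * (disc_q1 a b n + eta * disc_q2 n)) u);
    [|apply disc_p_shift|apply disc_q_shift|reflexivity].
  rewrite lower_order_plus_pq.
  rewrite (lower_order_scal_pq disc_p1 (fun n => disc_q1 a b n + eta * disc_q2 n)). ring.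
Qed.

Lemma disc_coef_deriv_fuchs a b c k :
  (forall k, INR k + c <> 0) ->
  fuchs c (disc_p a b c) (disc_q a b) (disc_coef_deriv a b c) k
  = - lower_order disc_p1 (disc_q1 a b) (disc_coef a b c) k.
Proof.
  intros Hc. exact (fuchs_solution_spec c _ _
    (fun k => - lower_order disc_p1 (disc_q1 a b) (disc_coef a b c) k) 0 Hc k).
Qed.

(** Both the increment and the first-order Taylor remainder of the coefficients
    solve the recurrence at the base point with a small source, so the bound for
    solutions makes them small, uniformly against a geometric sequence. *)
Lemma disc_coef_taylor a b c r :
  (forall k, INR k + c <> 0) -> 0 < r < 1 ->
  exists M : R, 0 <= M /\
    (forall k, Cmod (disc_coef_deriv a b c k) * r ^ k <= M) /\
    forall eta, Cmod eta <= 1 -> forall k,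
      Cmod (disc_coef (a + eta) (b + eta) c k - disc_coef a b c k - eta * disc_coef_deriv a b c k)
        * r ^ k <= M * (Cmod eta * Cmod eta).
Proof.
  intros Hc Hr.
  destruct (disc_uniform_bound a b c) as [K [HK Hbd]].
  destruct (fuchs_bound c K r Hc Hr HK) as [M [HM Hfb]].
  assert (Hgeo : forall U, 0 <= U -> 0 <= K * (U / (1 - r))).
  { intros U HU. apply Rmult_le_pos; [assumption|]. apply Rdiv_le_0_compat; lra. }
  assert (Hrk : forall k, 0 <= (r ^ k)%R) by (intros k; apply pow_le; lra).
  assert (H0 : Cmod 0 <= 1) by (rewrite Cmod_0; lra).
  destruct (Hbd 0 H0) as [Hp [Hq [Hp1 [Hq1 [_ Hq2]]]]].
  rewrite !Cplus_0_r in Hp, Hq.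
  assert (Hd : forall eta, Cmod eta <= 1 -> forall k,
    Cmod (disc_coef (a + eta) (b + eta) c k) * r ^ k <= M).
  { intros eta Heta k. destruct (Hbd eta Heta) as [Hpe [Hqe _]].
    specialize (Hfb _ _ (disc_coef (a + eta) (b + eta) c) 0%R Hpe Hqe (Rle_refl 0)).
    replace M with (M * (Cmod (disc_coef (a + eta) (b + eta) c 0) + 0))%R.
    - apply Hfb. intros n. rewrite disc_coef_fuchs, Cmod_0 by assumption. lra.
    - change (disc_coef (a + eta) (b + eta) c 0) with (RtoC 1). rewrite Cmod_1. ring. }
  set (S1 := (K * (M / (1 - r)))%R). assert (HS1 : 0 <= S1) by now apply Hgeo.
  set (D := (M * S1)%R). assert (HD : 0 <= D) by now apply Rmult_le_pos.
  set (S2 := (K * (D / (1 - r)) + S1)%R).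
  assert (HS2 : 0 <= S2) by (unfold S2; specialize (Hgeo D HD); lra).
  exists (D + M * S2)%R.
  assert (HMS2 : 0 <= M * S2) by now apply Rmult_le_pos.
  split; [lra|]. split.
  { intros k. apply Rle_trans with D; [|lra].
    replace D with (M * (Cmod (disc_coef_deriv a b c 0) + S1))%R.
    - apply (Hfb (disc_p a b c) (disc_q a b)); try assumption.
      intros n. rewrite disc_coef_deriv_fuchs, Cmod_opp by assumption.
      apply lower_order_bound; try assumption.
      intros j _. specialize (Hd 0 H0 j). now rewrite !Cplus_0_r in Hd.
    - change (disc_coef_deriv a b c 0) with (RtoC 0). rewrite Cmod_0. unfold D. ring. }
  intros eta Heta.
  destruct (Hbd eta Heta) as [_ [_ [_ [_ [Hq12 _]]]]].
  assert (He := Cmod_ge_0 eta).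
  set (u := disc_coef (a + eta) (b + eta) c).
  set (u0 := disc_coef a b c). set (u1 := disc_coef_deriv a b c).
  assert (Hu : forall k, fuchs c (disc_p a b c) (disc_q a b) u k =
    - (eta * lower_order disc_p1 (fun n => disc_q1 a b n + eta * disc_q2 n) u k)).
  { intros k. assert (E := disc_coef_fuchs (a + eta) (b + eta) c k Hc).
    rewrite fuchs_shift in E. fold u in E.
    set (w := lower_order disc_p1 (fun n => disc_q1 a b n + eta * disc_q2 n) u k) in *.
    replace (- (eta * w)) with (0 - eta * w) by ring. rewrite <- E. ring. }
  (* The increment has a source of order [eta]. *)
  set (del := fun k => u k + (- (1)) * u0 k).
  assert (Hdel : forall k, Cmod (del k) * r ^ k <= D * Cmod eta).
  { intros k.
    replace (D * Cmod eta)%R with (M * (Cmod (del 0%nat) + Cmod eta * S1))%R.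
    - apply (Hfb (disc_p a b c) (disc_q a b)); try assumption.
      { now apply Rmult_le_pos. }
      intros n. unfold del. rewrite fuchs_plus_u, fuchs_scal_u, Hu.
      unfold u0. rewrite disc_coef_fuchs by assumption.
      replace (- (eta * lower_order disc_p1 (fun n => disc_q1 a b n + eta * disc_q2 n) u n)
               + (- (1)) * 0)
        with (- (eta * lower_order disc_p1 (fun n => disc_q1 a b n + eta * disc_q2 n) u n)) by ring.
      rewrite Cmod_opp, Cmod_mult, Rmult_assoc.
      replace (INR (S n) * (Cmod eta * S1))%R with (Cmod eta * (INR (S n) * S1))%R by ring.
      apply Rmult_le_compat_l; [assumption|].
      apply lower_order_bound; try assumption. intros j _. now apply Hd.
    - unfold del, u, u0. change (disc_coef (a + eta) (b + eta) c 0) with (RtoC 1).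
      change (disc_coef a b c 0) with (RtoC 1).
      replace (1 + (- (1)) * 1) with (RtoC 0) by ring. rewrite Cmod_0. unfold D. ring. }
  (* In the source of the remainder the terms of order [eta] combine into the
     increment just bounded, which leaves order [eta ^ 2]. *)
  set (rem := fun k => del k + (- eta) * u1 k).
  assert (Hrem : forall k, Cmod (rem k) * r ^ k <= M * (S2 * (Cmod eta * Cmod eta))).
  { intros k.
    replace (M * (S2 * (Cmod eta * Cmod eta)))%R
      with (M * (Cmod (rem 0%nat) + (S2 * (Cmod eta * Cmod eta))))%R.
    - apply (Hfb (disc_p a b c) (disc_q a b)); try assumption.
      { apply Rmult_le_pos; [assumption|]. now apply Rmult_le_pos. }
      intros n. unfold rem. rewrite fuchs_plus_u, fuchs_scal_u.
      unfold del at 1. rewrite fuchs_plus_u, fuchs_scal_u, Hu.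
      unfold u0 at 1, u1. rewrite disc_coef_fuchs, disc_coef_deriv_fuchs by assumption.
      assert (E1 : lower_order disc_p1 (fun n => disc_q1 a b n + eta * disc_q2 n) u n =
        lower_order disc_p1 (disc_q1 a b) u n + eta * lower_order (fun _ => RtoC 0) disc_q2 u n).
      { rewrite <- lower_order_scal_pq, <- lower_order_plus_pq.
        apply lower_order_ext; intros; try reflexivity. ring. }
      assert (E2 : lower_order disc_p1 (disc_q1 a b) del n =
        lower_order disc_p1 (disc_q1 a b) u n
        + (- (1)) * lower_order disc_p1 (disc_q1 a b) u0 n).
      { unfold del. now rewrite lower_order_plus_u, lower_order_scal_u. }
      replace (- (eta * lower_order disc_p1 (fun n => disc_q1 a b n + eta * disc_q2 n) u n)
        + (- (1)) * 0 + (- eta) * - lower_order disc_p1 (disc_q1 a b) (disc_coef a b c) n)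
        with (- (eta * lower_order disc_p1 (disc_q1 a b) del n
                 + eta * eta * lower_order (fun _ => RtoC 0) disc_q2 u n))
        by (rewrite E1, E2; fold u0; ring).
      rewrite Cmod_opp.
      assert (L1 := lower_order_bound K r (D * Cmod eta) disc_p1 (disc_q1 a b) del n Hr HK
        Hp1 Hq1 (fun j _ => Hdel j)).
      assert (L2 : Cmod (lower_order (fun _ => RtoC 0) disc_q2 u n) * r ^ n
                   <= INR (S n) * (K * (M / (1 - r)))).
      { apply lower_order_bound; try assumption.
        - intros _. rewrite Cmod_0. assumption.
        - intros j _. now apply Hd. }
      eapply Rle_trans; [apply Rmult_le_compat_r; [apply Hrk|apply Cmod_triangle]|].
      rewrite !Cmod_mult, Rmult_plus_distr_r.
      apply Rle_trans with (Cmod eta * (INR (S n) * (K * (D * Cmod eta / (1 - r))))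
        + Cmod eta * Cmod eta * (INR (S n) * (K * (M / (1 - r)))))%R.
      + apply Rplus_le_compat; rewrite Rmult_assoc; apply Rmult_le_compat_l; try assumption.
        now apply Rmult_le_pos.
      + right. unfold S2, S1. field. lra.
    - unfold rem, del, u, u0, u1. change (disc_coef (a + eta) (b + eta) c 0) with (RtoC 1).
      change (disc_coef a b c 0) with (RtoC 1). change (disc_coef_deriv a b c 0) with (RtoC 0).
      replace (1 + (- (1)) * 1 + (- eta) * 0) with (RtoC 0) by ring. rewrite Cmod_0. ring. }
  intros k.
  replace (u k - u0 k - eta * u1 k) with (rem k) by (unfold rem, del; ring).
  eapply Rle_trans; [apply Hrem|].
  assert (0 <= D * (Cmod eta * Cmod eta)).
  { apply Rmult_le_pos; [assumption|]. now apply Rmult_le_pos. }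
  lra.
Qed.

Lemma hyp2F1_derive_parameter a b c x :
  (forall k, INR k + c <> 0) -> slit_plane x ->
  exists D, ps_on 1 (disc_coef_deriv a b c) D /\
    C_is_derive (fun eta => hyp2F1 (a + eta) (b + eta) c x) (RtoC 0) (D (disc_coord x)).
Proof.
  intros Hc Hx.
  destruct (ps_on_of_bounds 1 (disc_coef_deriv a b c)) as [D HD].
  { intros s Hs. destruct (disc_coef_taylor a b c ((1 + s) / 2) Hc ltac:(lra)) as [M [_ [HM _]]].
    exists M. intros k. eapply Rle_trans; [|apply HM].
    apply Rmult_le_compat_l; [apply Cmod_ge_0|]. apply pow_incr. lra. }
  exists D. split; [assumption|].
  assert (Hw : Cmod (disc_coord x) < 1) by now apply disc_coord_spec.
  set (w := disc_coord x) in *. assert (Hw0 := Cmod_ge_0 w).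
  set (r := ((1 + Cmod w) / 2)%R). assert (Hr : 0 < r < 1) by (unfold r; lra).
  destruct (disc_coef_taylor a b c r Hc Hr) as [M [HM [_ HT]]].
  set (q := (Cmod w / r)%R).
  assert (Hq : 0 <= q < 1).
  { unfold q. split; [apply Rdiv_le_0_compat; lra|]. apply (proj2 (Rlt_div_l _ _ r (proj1 Hr))).
    unfold r. lra. }
  set (B := (M * / (1 - q))%R).
  assert (HB : 0 <= B).
  { apply Rmult_le_pos; [assumption|]. apply Rlt_le, Rinv_0_lt_compat. lra. }
  assert (Hmain : forall eta, Cmod eta <= 1 ->
    Cmod (hyp2F1 (a + eta) (b + eta) c x - hyp2F1 a b c x - eta * D w)
      <= B * (Cmod eta * Cmod eta)).
  { intros eta Heta.
    destruct (disc_series_converges a b c Hc) as [P0 HP0].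
    destruct (disc_series_converges (a + eta) (b + eta) c Hc) as [P1 HP1].
    rewrite (hyp2F1_disc a b c P0 x Hc HP0 Hx), (hyp2F1_disc _ _ c P1 x Hc HP1 Hx). fold w.
    apply (is_series_C_norm_le (fun k => (disc_coef (a + eta) (b + eta) c k - disc_coef a b c k
      - eta * disc_coef_deriv a b c k) * w ^ k) _
      (fun k => M * (Cmod eta * Cmod eta) * q ^ k)%R).
    - eapply is_series_ext; [|apply (is_series_C_minus _ _ _ _
        (is_series_C_minus _ _ _ _ (ps_on_series 1 _ _ w HP1 Hw) (ps_on_series 1 _ _ w HP0 Hw))
        (is_series_C_scal eta _ _ (ps_on_series 1 _ _ w HD Hw)))].
      intros k. simpl. ring.
    - intros k. rewrite Cmod_mult, Cmod_pow. specialize (HT eta Heta k).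
      unfold q, Rdiv. rewrite Rpow_mult_distr, pow_inv.
      assert (Hrk : 0 < (r ^ k)%R) by (apply pow_lt; lra).
      set (t := Cmod (disc_coef (a + eta) (b + eta) c k - disc_coef a b c k
        - eta * disc_coef_deriv a b c k)) in *.
      replace (t * Cmod w ^ k)%R with (t * r ^ k * (Cmod w ^ k * / r ^ k))%R by (field; lra).
      apply Rmult_le_compat_r; [|assumption].
      apply Rmult_le_pos; [now apply pow_le|]. apply Rlt_le, Rinv_0_lt_compat. assumption.
    - replace (B * (Cmod eta * Cmod eta))%R with (M * (Cmod eta * Cmod eta) * / (1 - q))%R
        by (unfold B; ring).
      apply (is_series_scal (V := R_NormedModule)), is_series_geom.
      rewrite Rabs_pos_eq; lra. }
  apply is_derive_C_eps. intros eps Heps.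
  exists (Rmin 1 (eps / (B + 1))). split.
  { apply Rmin_glb_lt; [lra|]. apply Rdiv_lt_0_compat; lra. }
  intros h Hh.
  assert (H1 := Rlt_le_trans _ _ _ Hh (Rmin_l _ _)).
  assert (H2 := Rlt_le_trans _ _ _ Hh (Rmin_r _ _)).
  rewrite !Cplus_0_l, !Cplus_0_r.
  eapply Rle_trans; [apply Hmain; lra|].
  rewrite <- Rmult_assoc. apply Rmult_le_compat_r; [apply Cmod_ge_0|].
  apply Rlt_div_r in H2; [|lra]. pose proof (Cmod_ge_0 h). nra.
Qed.

(** * The logarithm in the disc coordinate *)

(** Coefficients of [2 log ((1 + z) / (1 - z))]. *)
Definition log_coef (k : nat) : C :=
  match k with O => 0 | S j => 4 * even_coef j * / INR (S j) end.

Lemma deriv_log_coef k : deriv_coef log_coef k = 4 * even_coef k.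
Proof. unfold deriv_coef, log_coef. field. apply INR_S_neq_0. Qed.

Lemma ps_on_log :
  exists L, ps_on 1 log_coef L /\
    forall z, Cmod z < 1 -> C_is_derive L z (4 * / (1 - z * z)).
Proof.
  destruct (ps_on_of_bounded log_coef 4) as [L HL].
  { intros [|j]; cbn [log_coef]; [rewrite Cmod_0; lra|].
    rewrite !Cmod_mult, Cmod_inv, !Cmod_nonneg_real
      by (apply INR_S_neq_0 || apply pos_INR || lra).
    pose proof (Cmod_even_coef j). pose proof (Cmod_ge_0 (even_coef j)).
    assert (1 <= INR (S j)) by (rewrite S_INR; pose proof (pos_INR j); lra).
    assert (/ INR (S j) <= 1) by (rewrite <- Rinv_1; apply Rinv_le_contravar; lra).
    assert (0 < (/ INR (S j))%R) by (apply Rinv_0_lt_compat; lra). nra. }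
  exists L. split; [assumption|].
  destruct (ps_on_derive 1 _ _ HL) as [HL' Hd]. intros z Hz.
  assert (E : C_derive L z = 4 * / (1 - z * z)).
  { apply (is_series_C_unique _ _ _ (ps_on_series 1 _ _ z HL' Hz)).
    eapply is_series_ext;
      [|exact (ps_on_series 1 _ _ z (ps_on_scal 1 4 _ _ ps_on_even) Hz)].
    intros k. simpl. now rewrite deriv_log_coef. }
  rewrite <- E. now apply Hd.
Qed.

(** With [Phi] the sum of the [disc_coef] series, [L * Phi] solves the equation obtained
    by differentiating that of [Phi] in the parameter: applying the operator to the
    product gives [2 z L' Phi' + (z L'' + (c + z P) L') Phi], and [L' = 4 / (1 - z ^ 2)]. *)
Lemma disc_coef_deriv_log a b :
  (forall k, INR k + (a + b) <> 0) ->
  forall k, conv log_coef (disc_coef a b (a + b)) k = disc_coef_deriv a b (a + b) k.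
Proof.
  intros Hc. set (c := a + b) in *.
  destruct (disc_series_converges a b c Hc) as [Phi HPhi].
  destruct ps_on_log as [L [HL HdL]].
  set (G := fun z => L z * Phi z).
  assert (HG : ps_on 1 (conv log_coef (disc_coef a b c)) G) by exact (ps_on_mult 1 _ _ _ _ HL HPhi).
  destruct (ps_on_derive 1 _ _ HPhi) as [HPhi1 HdPhi].
  destruct (ps_on_derive 1 _ _ HPhi1) as [_ HdPhi1].
  assert (HdL2 : forall z, Cmod z < 1 ->
    C_is_derive (fun z => 4 * / (1 - z * z)) z (8 * z * / ((1 - z * z) * (1 - z * z)))).
  { intros z Hz.
    assert (Hn : 1 - z * z <> 0).
    { replace (1 - z * z) with ((1 - z) * (1 + z)) by ring.
      apply Cmult_neq_0; [now apply one_minus_neq_0|now apply one_plus_neq_0]. }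
    eapply is_derive_C_val; cycle 1.
    - apply (is_derive_C_mult (fun _ => RtoC 4) (fun z => / (1 - z * z))); [apply is_derive_C_const|].
      apply (is_derive_C_comp Cinv (fun z => 1 - z * z)); [now apply is_derive_C_inv|].
      apply (is_derive_minus (V := C_NormedModule) (fun _ => RtoC 1) (fun z : C => z * z)).
      + apply is_derive_C_const.
      + apply (is_derive_C_mult (fun z => z) (fun z => z)); apply is_derive_C_id.
    - change (minus ?x ?y) with (x - y). simpl. field. assumption. }
  assert (HG1 : forall z, Cmod z < 1 ->
    C_derive G z = 4 * / (1 - z * z) * Phi z + L z * C_derive Phi z).
  { intros z Hz. apply is_C_derive_unique. apply is_derive_C_mult; auto. }
  assert (HG2 : forall z, Cmod z < 1 -> C_derive (C_derive G) z =
    (8 * z * / ((1 - z * z) * (1 - z * z)) * Phi z + 4 * / (1 - z * z) * C_derive Phi z)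
    + (4 * / (1 - z * z) * C_derive Phi z + L z * C_derive (C_derive Phi) z)).
  { intros z Hz. apply is_C_derive_unique.
    apply (is_derive_C_ext_near
      (fun z => 4 * / (1 - z * z) * Phi z + L z * C_derive Phi z) _ z _ (1 - Cmod z)); [lra| |].
    - intros y Hy. symmetry. apply HG1.
      replace y with ((y - z) + z) by ring.
      eapply Rle_lt_trans; [apply Cmod_triangle|]. lra.
    - apply (is_derive_C_plus (fun z => 4 * / (1 - z * z) * Phi z) (fun z => L z * C_derive Phi z)).
      + apply (is_derive_C_mult (fun z => 4 * / (1 - z * z)) Phi); auto.
      + apply (is_derive_C_mult L (C_derive Phi)); auto. }
  assert (Hsrc : ps_on 1 (fun k => - (1) * lower_order disc_p1 (disc_q1 a b) (disc_coef a b c) k)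
    (fun z => - (1) * (- (8) * / (1 - z * z) * (z * C_derive Phi z)
      + - (4 * c) * / ((1 + z) * (1 + z)) * Phi z))).
  { apply ps_on_scal. apply ps_on_plus.
    - apply ps_on_mult; [exact (ps_on_scal 1 (- (8)) _ _ ps_on_even)|].
      exact (ps_on_theta 1 _ _ HPhi).
    - apply ps_on_mult; [|assumption]. exact (ps_on_scal 1 (- (4 * c)) _ _ ps_on_alt_square). }
  apply (fuchs_unique c (disc_p a b c) (disc_q a b)); [assumption| |].
  - unfold conv. rewrite sum_O. change (disc_coef_deriv a b c 0) with (RtoC 0).
    change (0 * disc_coef a b c 0%nat = 0). ring.
  - intros k. rewrite disc_coef_deriv_fuchs by assumption.
    replace (- lower_order disc_p1 (disc_q1 a b) (disc_coef a b c) k)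
      with (- (1) * lower_order disc_p1 (disc_q1 a b) (disc_coef a b c) k) by ring.
    apply (ps_on_unique 1 _
      (fun k => - (1) * lower_order disc_p1 (disc_q1 a b) (disc_coef a b c) k) _ Rlt_0_1
      (ps_on_fuchs 1 c _ _ _ _ _ G (ps_on_disc_p a b c) (ps_on_disc_q a b) HG)).
    eapply ps_on_ext; [reflexivity| |exact Hsrc].
    intros z Hz. rewrite HG1, HG2 by assumption.
    assert (Hode : z * C_derive (C_derive Phi) z + (c + z * disc_P a b c z) * C_derive Phi z
              + disc_Q a b z * Phi z = 0).
    { assert (H := ps_on_fuchs 1 c _ _ _ _ _ Phi (ps_on_disc_p a b c) (ps_on_disc_q a b) HPhi).
      apply (is_series_C_unique _ _ _ (ps_on_series 1 _ _ z H Hz)).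
      eapply is_series_ext; [|exact (ps_on_series 1 _ _ z (ps_on_0 1) Hz)].
      intros n. simpl. now rewrite disc_coef_fuchs. }
    assert (Hm := one_minus_neq_0 z Hz). assert (Hp := one_plus_neq_0 z Hz).
    assert (H1 : z * C_derive (C_derive Phi) z
      = - ((c + z * disc_P a b c z) * C_derive Phi z + disc_Q a b z * Phi z)).
    { replace (z * C_derive (C_derive Phi) z) with (0
        - ((c + z * disc_P a b c z) * C_derive Phi z + disc_Q a b z * Phi z)); [ring|].
      rewrite <- Hode. ring. }
    set (F2 := C_derive (C_derive Phi) z) in *. set (F1 := C_derive Phi z) in *.
    unfold G. set (F0 := Phi z). fold F0 in H1. set (l := L z).
    replace (z * (8 * z * / ((1 - z * z) * (1 - z * z)) * F0 + 4 * / (1 - z * z) * F1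
        + (4 * / (1 - z * z) * F1 + l * F2)))
      with (z * (8 * z * / ((1 - z * z) * (1 - z * z)) * F0 + 8 * / (1 - z * z) * F1)
        + l * (z * F2)) by ring.
    rewrite H1. unfold disc_P, disc_Q. unfold c.
    replace (1 - z * z) with ((1 - z) * (1 + z)) by ring.
    field. now split.
Qed.

(** * The principal logarithm *)

(** In the open right half-plane the argument is [atan (q / p)], and its double stays
    within the range of the principal argument. *)
Lemma Arg_square p q : 0 < p -> Arg ((p, q) * (p, q)) = (2 * atan (q / p))%R.
Proof.
  intros Hp. set (u := (q / p)%R). set (th := atan u).
  assert (Hpq : 0 < (p * p + q * q)%R) by nra.
  assert (Hm : Cmod ((p, q) * (p, q)) = (p * p + q * q)%R).
  { rewrite Cmod_mult. replace (Cmod (p, q) * Cmod (p, q))%R with (Cmod (p, q) ^ 2)%R by ring.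
    rewrite Cmod2_alt. simpl. ring. }
  assert (Hcos : cos (2 * th) = (Re ((p, q) * (p, q)) / Cmod ((p, q) * (p, q)))%R).
  { rewrite Hm, cos_2a. unfold th.
    rewrite cos_atan, sin_atan.
    assert (Hs : 0 < 1 + u²) by (pose proof (Rle_0_sqr u); lra).
    assert (Hss := sqrt_sqrt (1 + u²) ltac:(lra)).
    assert (Hsp : 0 < sqrt (1 + u²)) by now apply sqrt_lt_R0.
    replace (1 / sqrt (1 + u²) * (1 / sqrt (1 + u²)) - u / sqrt (1 + u²) * (u / sqrt (1 + u²)))%R
      with ((1 - u * u) / (sqrt (1 + u²) * sqrt (1 + u²)))%R by (field; lra).
    rewrite Hss. simpl. unfold u, Rsqr. field. repeat split; nra. }
  assert (Hb := atan_bound u). fold th in Hb.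
  assert (Him : Im ((p, q) * (p, q)) = (2 * p * q)%R) by (simpl; ring).
  unfold Arg. rewrite <- Hcos, Him.
  destruct (Rle_dec 0 (2 * p * q)) as [H|H].
  - assert (Hu : 0 <= u) by (unfold u; apply Rdiv_le_0_compat; nra).
    assert (Hth : 0 <= th).
    { destruct Hu as [Hu|Hu]; [|unfold th; rewrite <- Hu, atan_0; lra].
      rewrite <- atan_0. left. now apply atan_increasing. }
    apply acos_cos. lra.
  - assert (Hu : u < 0) by (unfold u; apply Rlt_div_l; nra).
    assert (Hth : th < 0) by (rewrite <- atan_0; now apply atan_increasing).
    rewrite <- cos_neg, acos_cos by lra. ring.
Qed.

(** Real and imaginary parts of [2 log ((1 + t w) / (1 - t w))]. *)
Definition log_re (w : C) (t : R) : R :=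
  ln ((1 + 2 * t * Re w + t * t * (Re w * Re w + Im w * Im w))
    / (1 - 2 * t * Re w + t * t * (Re w * Re w + Im w * Im w))).

Definition log_im (w : C) (t : R) : R :=
  (2 * atan (2 * t * Im w / (1 - t * t * (Re w * Re w + Im w * Im w))))%R.

Lemma neg_Log_cayley w y :
  Cmod w < 1 -> y = (1 - w) / (1 + w) -> - Log (y * y) = (log_re w 1, log_im w 1).
Proof.
  intros Hw Hy.
  assert (Hwp := one_plus_neq_0 w Hw). assert (Hwm := one_minus_neq_0 w Hw).
  assert (Hm2 := Cmod2_alt w). assert (Hw0 := Cmod_ge_0 w).
  assert (Hrho : (Re w * Re w + Im w * Im w < 1)%R) by nra.
  assert (Hp2 := Cmod2_alt (1 + w)). assert (Hn2 := Cmod2_alt (1 - w)).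
  change (Re (1 + w)) with (1 + Re w)%R in Hp2. change (Im (1 + w)) with (0 + Im w)%R in Hp2.
  change (Re (1 - w)) with (1 - Re w)%R in Hn2. change (Im (1 - w)) with (0 - Im w)%R in Hn2.
  apply Cmod_gt_0 in Hwp as Hwp'. apply Cmod_gt_0 in Hwm as Hwm'.
  destruct w as [al be]. simpl Re in *. simpl Im in *.
  assert (HN : 0 < ((1 + al) * (1 + al) + be * be)%R) by nra.
  assert (HM : 0 < ((1 - al) * (1 - al) + be * be)%R) by nra.
  assert (Ey : y = ((1 - (al * al + be * be)) / ((1 + al) * (1 + al) + be * be),
                    (- (2 * be)) / ((1 + al) * (1 + al) + be * be))%R).
  { rewrite Hy. unfold Cdiv, Cinv, Cmult, Cminus, Cplus, Copp, RtoC. simpl.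
    f_equal; field; nra. }
  unfold Log, log_re, log_im. unfold Copp. simpl fst. simpl snd. simpl Re. simpl Im. f_equal.
  - rewrite Cmod_mult, Hy, Cmod_div by assumption.
    set (m := Cmod (1 - (al, be))) in *. set (n := Cmod (1 + (al, be))) in *.
    rewrite <- ln_Rinv by (apply Rmult_lt_0_compat; apply Rdiv_lt_0_compat; assumption).
    f_equal.
    replace (/ (m / n * (m / n)))%R with (n ^ 2 / m ^ 2)%R by (field; lra).
    rewrite Hp2, Hn2. f_equal; ring.
  - rewrite Ey, Arg_square by (apply Rdiv_lt_0_compat; lra).
    rewrite Ropp_mult_distr_r, <- atan_opp. f_equal. f_equal. field. nra.
Qed.

(** Both sides vanish at 0 and have the same derivative along the ray through [w]. *)
Lemma log_series_eq L w :
  ps_on 1 log_coef L -> (forall z, Cmod z < 1 -> C_is_derive L z (4 * / (1 - z * z))) ->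
  Cmod w < 1 -> L w = (log_re w 1, log_im w 1).
Proof.
  intros HL HdL Hw.
  set (D := fun t : R => w * (4 * / (1 - RtoC t * w * (RtoC t * w)))).
  assert (Htw : forall t, 0 <= t <= 1 -> Cmod (RtoC t * w) < 1).
  { intros t Ht. rewrite Cmod_mult, Cmod_nonneg_real by lra. pose proof (Cmod_ge_0 w). nra. }
  assert (Hray : forall t, 0 <= t <= 1 -> forall eps, 0 < eps -> exists d, 0 < d /\
    forall h : R, Rabs h < d ->
      Cmod (L (RtoC (t + h) * w) - L (RtoC t * w) - RtoC h * D t) <= eps * Rabs h).
  { intros t Ht eps Heps.
    destruct (proj1 (is_derive_C_eps _ _ _) (HdL _ (Htw t Ht)) eps Heps) as [d [Hd H]].
    exists d. split; [assumption|]. intros h Hh.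
    specialize (H (RtoC h * w)). rewrite Cmod_mult, Cmod_R in H.
    pose proof (Rabs_pos h) as Hh0. pose proof (Cmod_ge_0 w) as Hw0.
    assert (Hhw : Rabs h * Cmod w <= Rabs h).
    { rewrite <- (Rmult_1_r (Rabs h)) at 2. apply Rmult_le_compat_l; lra. }
    specialize (H ltac:(lra)).
    replace (RtoC (t + h) * w) with (RtoC t * w + RtoC h * w) by (rewrite RtoC_plus; ring).
    replace (RtoC h * D t) with (RtoC h * w * (4 * / (1 - RtoC t * w * (RtoC t * w))))
      by (unfold D; ring).
    eapply Rle_trans; [exact H|]. apply Rmult_le_compat_l; lra. }
  assert (Hcomp : forall (pr : C -> R) t, 0 <= t <= 1 ->
    (forall x y, pr (x - y) = (pr x - pr y)%R) -> (forall (h : R) x, pr (RtoC h * x) = (h * pr x)%R) ->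
    (forall x, Rabs (pr x) <= Cmod x) ->
    is_derive (fun s : R => pr (L (RtoC s * w))) t (pr (D t))).
  { intros pr t Ht Hsub Hscal Hle. apply is_derive_Reals. intros eps Heps.
    destruct (Hray t Ht (eps / 2)%R ltac:(lra)) as [d [Hd H]].
    exists (mkposreal d Hd). intros h Hh Hhd. specialize (H h Hhd).
    assert (Hh0 : 0 < Rabs h) by now apply Rabs_pos_lt.
    replace ((pr (L (RtoC (t + h) * w)%C) - pr (L (RtoC t * w)%C)) / h - pr (D t))%R
      with (pr (L (RtoC (t + h) * w)%C - L (RtoC t * w)%C - RtoC h * D t)%C / h)%R
      by (rewrite !Hsub, Hscal; field; assumption).
    unfold Rdiv. rewrite Rabs_mult, Rabs_inv.
    apply Rle_lt_trans with (eps / 2 * Rabs h * / Rabs h)%R.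
    - apply Rmult_le_compat_r; [apply Rlt_le, Rinv_0_lt_compat; assumption|].
      eapply Rle_trans; [apply Hle|exact H].
    - rewrite Rmult_assoc, Rinv_r by lra. lra. }
  assert (HL0 : L 0 = 0) by exact (ps_on_at_0 1 _ _ Rlt_0_1 HL).
  assert (Hm2 := Cmod2_alt w). assert (Hw0 := Cmod_ge_0 w).
  set (al := Re w) in *. set (be := Im w) in *.
  assert (Hrho : (al * al + be * be < 1)%R) by nra.
  assert (Hpos : forall t, 0 <= t <= 1 ->
    0 < (1 + 2 * t * al + t * t * (al * al + be * be))%R /\
    0 < (1 - 2 * t * al + t * t * (al * al + be * be))%R /\
    0 < (1 - t * t * (al * al + be * be))%R).
  { intros t Ht. assert (Hal : -1 < al < 1) by nra.
    assert (Hta : -1 < t * al < 1) by nra.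
    assert (Htb : 0 <= (t * be) * (t * be)) by nra.
    assert (H1 : 0 < (1 + t * al) * (1 + t * al)) by nra.
    assert (H2 : 0 < (1 - t * al) * (1 - t * al)) by nra.
    assert (Htt : 0 <= t * t <= 1) by nra.
    repeat split; nra. }
  assert (HD : forall t, 0 <= t <= 1 -> D t =
    (4 * al * (1 - t * t * (al * al + be * be))
       / ((1 + 2 * t * al + t * t * (al * al + be * be)) * (1 - 2 * t * al + t * t * (al * al + be * be))),
     4 * be * (1 + t * t * (al * al + be * be))
       / ((1 + 2 * t * al + t * t * (al * al + be * be)) * (1 - 2 * t * al + t * t * (al * al + be * be))))%R).
  { intros t Ht. destruct (Hpos t Ht) as [H1 [H2 H3]].
    unfold D. subst al be. destruct w as [al be]. simpl in *.
    unfold Cinv, Cmult, Cminus, Cplus, Copp, RtoC. simpl.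
    f_equal; field; split; try lra; nra. }
  assert (Hre : Re (L w) = log_re w 1).
  { assert (E : (Re (L (RtoC 0 * w)%C) - log_re w 0)%R = (Re (L (RtoC 1 * w)%C) - log_re w 1)%R).
    { apply (eq_is_derive (fun t : R => (Re (L (RtoC t * w)%C) - log_re w t)%R)); [|lra].
      intros t Ht. destruct (Hpos t Ht) as [H1 [H2 H3]].
      assert (E : is_derive (fun t : R => (Re (L (RtoC t * w)%C) - log_re w t)%R) t
                    (Re (D t) - Re (D t))%R); [|now rewrite Rminus_diag in E].
      apply (is_derive_minus (fun s : R => Re (L (RtoC s * w))) (log_re w)).
      - apply Hcomp; [assumption| | |].
        + intros x y. reflexivity.
        + intros h x. apply re_scal_l.
        + apply re_le_Cmod.
      - rewrite HD by assumption. unfold log_re. fold al be. simpl Re. auto_derive.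
        + repeat split; try lra. apply Rdiv_lt_0_compat; lra.
        + field. lra. }
    rewrite Cmult_0_l, HL0, Cmult_1_l in E.
    assert (E0 : log_re w 0 = 0%R).
    { unfold log_re. rewrite !Rmult_0_r, !Rmult_0_l, Rminus_0_r, !Rplus_0_r, Rdiv_1_r.
      apply ln_1. }
    rewrite E0 in E. simpl in E. unfold Re. unfold Re in E. lra. }
  assert (Him : Im (L w) = log_im w 1).
  { assert (E : (Im (L (RtoC 0 * w)%C) - log_im w 0)%R = (Im (L (RtoC 1 * w)%C) - log_im w 1)%R).
    { apply (eq_is_derive (fun t : R => (Im (L (RtoC t * w)%C) - log_im w t)%R)); [|lra].
      intros t Ht. destruct (Hpos t Ht) as [H1 [H2 H3]].
      assert (E : is_derive (fun t : R => (Im (L (RtoC t * w)%C) - log_im w t)%R) t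
                    (Im (D t) - Im (D t))%R); [|now rewrite Rminus_diag in E].
      apply (is_derive_minus (fun s : R => Im (L (RtoC s * w))) (log_im w)).
      - apply Hcomp; [assumption| | |].
        + intros x y. reflexivity.
        + intros h x. apply im_scal_l.
        + intros x. eapply Rle_trans; [|apply Rmax_Cmod]. apply Rmax_r.
      - rewrite HD by assumption. unfold log_im. fold al be. simpl Im. auto_derive.
        + lra.
        + field. repeat split; try lra. nra. }
    rewrite Cmult_0_l, HL0, Cmult_1_l in E.
    assert (E0 : log_im w 0 = 0%R).
    { unfold log_im. rewrite !Rmult_0_r, !Rmult_0_l, Rdiv_0_l, atan_0. apply Rmult_0_r. }
    rewrite E0 in E. simpl in E. unfold Im. unfold Im in E. lra. }
  rewrite <- Hre, <- Him. apply surjective_pairing.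
Qed.

Theorem proposition3 (a b : C)
  (hab : forall n : nat, (1 <= n)%nat -> 1 - (a + b) <> INR n)
  (x : C) (hx : slit_plane x) :
  holomorphic_near (fun eps : C => hyp2F1 (a + eps) (b + eps) (a + b) x) 0 /\
  first_coef (fun eps : C => hyp2F1 (a + eps) (b + eps) (a + b) x)
    = - Log (1 - x) * hyp2F1 a b (a + b) x.
Proof.
  assert (Hc : forall k, INR k + (a + b) <> 0).
  { intros k Hk. apply (hab (S k)); [lia|]. rewrite S_INR, RtoC_plus.
    replace (1 - (a + b)) with (INR k + 1 - (INR k + (a + b))) by ring.
    rewrite Hk. ring. }
  split.
  - unfold holomorphic_near. apply filter_forall. intros eps.
    destruct (hyp2F1_derive_parameter (a + eps) (b + eps) (a + b) x Hc hx) as [D [_ HD]].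
    exists (D (disc_coord x)).
    apply is_derive_C_translate.
    eapply is_derive_ext; [|exact HD].
    intros h. simpl. now rewrite !Cplus_assoc.
  - destruct (hyp2F1_derive_parameter a b (a + b) x Hc hx) as [D [HDs HD]].
    unfold first_coef. etransitivity; [exact (is_C_derive_unique _ _ _ HD)|].
    destruct (disc_series_converges a b (a + b) Hc) as [Phi HPhi].
    rewrite (hyp2F1_disc a b (a + b) Phi x Hc HPhi hx).
    destruct ps_on_log as [L [HL HdL]].
    destruct (disc_coord_spec x hx) as [_ [Hyy [Hw [Hy _]]]].
    rewrite <- Hyy, (neg_Log_cayley _ _ Hw Hy), <- (log_series_eq L _ HL HdL Hw).
    apply (is_series_C_unique _ _ _ (ps_on_series 1 _ _ _ HDs Hw)).
    eapply is_series_ext; [|exact (ps_on_series 1 _ _ _ (ps_on_mult 1 _ _ _ _ HL HPhi) Hw)].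
    intros k. simpl. now rewrite disc_coef_deriv_log.
Qed.
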